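(* Let $t_0,x_0\in\mathbb{R}$. Let $F_1,F_2:\mathbb{R}\to\mathbb{R}$ be bounded Lipschitz functions, both bounded by $M$ and both having Lipschitz constant less than or equal to $M$. Let $B_t$ be a continuous process such that (i) there exist $c_1>0$ and $\gamma\in(0,1)$ such that whenever $s<t$, $$\mathbb{P}(B_t\in dy\mid\mathcal F_s)\le\frac{c_1}{(t-s)^\gamma}\,dy,\qquad y\in\mathbb{R};$$ (ii) if $A_t$ is an adapted process with $A_{t_0}=x_0$ whose paths are Lipschitz continuous with Lipschitz constant $M$, then for each $x$ the law of $\{B_t+A_t,\ t_0\le t\le t_0+s\}$ under $\mathbb{P}^x$ is mutually absolutely continuous with respect to the law of $\{B_t,\ t_0\le t\le t_0+s\}$ under $\mathbb{P}^{x+x_0}$, for every $s>0$. Then with probability one there exists a unique Lipschitz solution, for all $t\ge t_0$, of the equation $$\frac{dX_t}{dt}=\begin{cases}F_1(X_t)&\text{if }X_t>B_t,\\ F_2(X_t)&\text{if }X_t<B_t,\end{cases}\qquad X(t_0)=x_0.$$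
   Context: A solution is a function $t\mapsto X_t$ with $X_{t_0}=x_0$ for which the displayed derivative condition holds at every $t$ with $X_t\ne B_t$ (no condition on the derivative when $X_t=B_t$). $\mathcal F_t=\sigma(B_s,s\in[t_0,t])$, and ''adapted'' refers to this filtration. $\mathbb{P}^x$ denotes the distribution of $\{B_t,t\ge t_0\}$ conditioned on $\{B_{t_0}=x\}$ (no Markov property is assumed). *)

(* Defs.v *)
From HB Require Import structures.
From mathcomp Require Import all_boot all_order all_algebra.
From mathcomp Require Import all_classical all_reals all_analysis.
Import Order.TTheory GRing.Theory Num.Theory.
Import numFieldNormedType.Exports.

Set Implicit Arguments.
Unset Strict Implicit.
Unset Printing Implicit Defensive.

Local Open Scope classical_set_scope.
Local Open Scope ring_scope.

(* [g_sigma_algebraType (generators J X)] is the carrier equipped with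
   sigma(X_i, i in J). *)
Definition generators d (T' : measurableType d) (I T : Type) (J : set I)
    (X : I -> T -> T') : set (set T) :=
  \bigcup_(i in J) preimage_set_system setT (X i) measurable.

(* C(I): functions on R whose restriction to I is continuous. The values
   outside I are irrelevant: the sigma-algebra put on C(I) below is generated
   by the evaluations at points of I only. *)
Definition contfun (R : realType) (I : set R) : Type :=
  continuousType (subspace I) R.

Section contfun_pointed.
Context (R : realType) (I : set R).
HB.instance Definition _ := Choice.on (contfun I).
HB.instance Definition _ :=
  isPointed.Build (contfun I) (cst (0 : R) : continuousType (subspace I) R).
End contfun_pointed.

Definition path_space (R : realType) (I : set R) :=
  g_sigma_algebraType
    (generators I (fun (t : R) (w : contfun I) => (w t : R))).
HB.instance Definition _ (R : realType) (I : set R) :=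
  Measurable.on (path_space I).

Definition eval_at (R : realType) (I : set R) (t : R) (w : path_space I) : R :=
  (w : contfun I) t.

Definition timeline (R : realType) (t0 : R) : set R := `[t0, +oo[.

(* The sigma-algebra F_t of the process X started at time t0. *)
Definition history (R : realType) d (T : measurableType d) (t0 : R)
    (X : R -> T -> R) (t : R) := g_sigma_algebraType (generators `[t0, t] X).
HB.instance Definition _ (R : realType) d (T : measurableType d) (t0 : R)
  (X : R -> T -> R) (t : R) := Measurable.on (history t0 X t).

Section path_operations.
Context (R : realType).

Lemma path_add_continuous (I : set R) (v w : path_space I) :
  continuous ((fun t => (v : contfun I) t + (w : contfun I) t)
              : subspace I -> R).
Proof.
move=> t; have vc := @cts_fun _ _ (v : contfun I) t.
have wc := @cts_fun _ _ (w : contfun I) t.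
exact: (cvgD vc wc).
Qed.

Definition path_add (I : set R) (v w : path_space I) : path_space I :=
  (mkcts (@path_add_continuous I v w) : continuousType _ _).

Lemma path_upto_continuous (t0 u : R) (w : path_space (timeline t0)) :
  continuous ((w : contfun (timeline t0)) : subspace `[t0, u] -> R).
Proof.
have : continuous ((w : contfun (timeline t0)) : subspace (timeline t0) -> R).
  exact: (@cts_fun _ _ (w : contfun (timeline t0))).
apply: continuous_subspaceW => t /=.
by rewrite /timeline /= !in_itv /= => /andP[->].
Qed.

Definition path_upto (t0 u : R) (w : path_space (timeline t0)) :
    path_space `[t0, u] :=
  (mkcts (@path_upto_continuous t0 u w) : continuousType _ _).

End path_operations.

(* [k] is a regular conditional distribution of [Y] given [X]. *)
Definition conditional_law d d1 d2 (T : measurableType d)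
    (T1 : measurableType d1) (T2 : measurableType d2) (R : realType)
    (P : probability T R) (X : T -> T1) (Y : T -> T2) (k : R.-pker T1 ~> T2) :=
  forall (U : set T1) (E : set T2), measurable U -> measurable E ->
    P (X @^-1` U `&` Y @^-1` E) = (\int[P]_(w in X @^-1` U) k (X w) E)%E.

(* Conditioning on the sigma-algebra F_s is conditioning on the identity map
   from the probability space to itself endowed with F_s. *)
Definition conditional_density_bound (R : realType) d (T : measurableType d)
    (P : probability T R) (t0 : R) (B : R -> T -> R) (c1 gamma : R) :=
  forall s t : R, t0 <= s -> s < t ->
    exists k : R.-pker (history t0 B s) ~> (measurableTypeR R),
      conditional_law P (idfun : T -> history t0 B s)
        (B t : T -> measurableTypeR R) k /\
      {ae P, forall w, forall A : set (measurableTypeR R), measurable A ->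
        (k w A <= (c1 / (t - s) `^ gamma)%:E * lebesgue_measure A)%E}.

(* [Px x] is the law on C([t0, +oo[) of [B] conditioned on {B_t0 = x}. As such
   a family is only determined up to a null set of [x]'s by the law of [B], it
   is an argument, required to be carried by {B_t0 = x} for every [x]. *)
Definition law_given_start (R : realType) d (T : measurableType d)
    (P : probability T R) (t0 : R) (B : T -> path_space (timeline t0))
    (Px : R.-pker (measurableTypeR R) ~> path_space (timeline t0)) :=
  conditional_law P (fun w => eval_at t0 (B w) : measurableTypeR R) B Px /\
  forall x : R, Px x [set w | eval_at t0 w = x] = 1%E.

(* An adapted process is a functional of the path. *)
Definition adapted (R : realType) (t0 : R)
    (A : path_space (timeline t0) -> path_space (timeline t0)) :=
  forall t, t0 <= t ->
    measurable_fun setT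
      ((fun w => eval_at t (A w)) :
        history t0 (@eval_at R (timeline t0)) t -> R).

Definition mutually_ac d (T : measurableType d) (R : realType)
    (mu nu : set T -> \bar R) := mu `<< nu /\ nu `<< mu.

Definition shift_quasi_invariant (R : realType) (t0 x0 M : R)
    (Px : R.-pker (measurableTypeR R) ~> path_space (timeline t0)) :=
  forall A : path_space (timeline t0) -> path_space (timeline t0),
    adapted A ->
    (forall w, eval_at t0 (A w) = x0) ->
    (forall w, M.-lipschitz_(timeline t0) (fun t : R => eval_at t (A w))) ->
    forall x s : R, 0 < s ->
      mutually_ac
        (pushforward (Px x) (fun w => path_upto (t0 + s) (path_add w (A w))))
        (pushforward (Px (x + x0)) (@path_upto R t0 (t0 + s))).

(* Derivative relative to D: one-sided at an end point of D. *)
Definition has_derivative_within (R : realType) (D : set R) (f : R -> R)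
    (t l : R) :=
  (fun s => (f s - f t) / (s - t)) @ within D t^' --> l.

Definition lipschitz_solution (R : realType) (F1 F2 : R -> R) (t0 x0 : R)
    (b X : R -> R) :=
  [/\ [lipschitz X t | t in timeline t0],
      X t0 = x0 &
      forall t, t0 <= t ->
        (b t < X t -> has_derivative_within (timeline t0) X t (F1 (X t))) /\
        (X t < b t -> has_derivative_within (timeline t0) X t (F2 (X t)))].

(* Main.v *)
(* Proof idea. Two solutions X and Y driven by the same path b only separate
   while b is between them: if |X - Y| <= e on an interval, then |X - Y| grows
   there by at most a constant times e (length) + (time during which
   |b - Y| <= 2 e). Call b - Y sparse when, at every small scale e = 2^-k, this
   time is at most e / q on each interval of length 1 / k. Then |X - Y| cannot
   grow from 2^-(k+1) to 2^-k in a time less than 1 / k, and since the sum of the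
   1 / k diverges it stays at 0. The same estimate makes Euler schemes converge.

   By (i) the probability that B - x0 visits (-e, e) at given times
   s_1 < ... < s_p is at most a product of factors 2 e c_1 / (s_i - s_{i-1})^gamma,
   so that, on intervals of length 1 / k, the moments of order p of (time) / e are
   of order k^(-(1-gamma) p), uniformly in e. For p large, this beats the k
   intervals, and Borel-Cantelli shows that B - x0 is almost surely sparse.

   It remains to replace B - x0 by B - X. The solution A = A(B) of
   dA/dt = F1 (A) if B < x0, F2 (A) if B > x0, A(t0) = x0, is adapted and
   Lipschitz, and it is a solution of the original equation driven by
   b = B + A - x0, for which b - A = B - x0 is sparse. Hence b is regular: its own
   Euler schemes converge, to a solution Y such that b - Y is sparse. This is
   a measurable property of b. By (ii), applied to A and to the constant process
   x0, the law of B is absolutely continuous with respect to the law of b given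
   the starting point, so that B is almost surely regular as well. *)
Require Import Defs.
From HB Require Import structures.
From mathcomp Require Import all_boot all_order all_algebra.
From mathcomp Require Import all_classical all_reals all_analysis.
From mathcomp Require Import measurable_realfun.
From mathcomp Require Import ring lra zify.
Import Order.TTheory GRing.Theory Num.Theory.
Import numFieldNormedType.Exports.

Local Open Scope classical_set_scope.
Local Open Scope ring_scope.

(** * Comparison of approximate solutions *)

Definition tick {R : realType} (t0 : R) (m i : nat) : R :=
  t0 + i%:R / m%:R.

Definition hits {R : realType} (t0 : R) (beta : R -> R) (eps : R)
    (m a l : nat) : nat :=
  count (fun i => `|beta (tick t0 m i)| < eps) (iota a l).

(* With step 1 / ((k + 1) (n + 1)), the window number j covers the times
   between t0 + j / (k + 1) and t0 + (j + 2) / (k + 1), hence contains every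
   interval of length 1 / (k + 1) starting in its first half. *)
Definition few_hits {R : realType} (t0 : R) (N : nat) (th : R) (k n : nat)
    (beta : R -> R) :=
  forall j, (j.+2 <= N * k.+1)%N ->
    (hits t0 beta (2 * 2^-1 ^+ k) (k.+1 * n.+1) (j * n.+1).+1 (2 * n.+1))%:R
      <= th * 2^-1 ^+ k * (k.+1 * n.+1)%:R.

(* For every q, at every small enough spatial scale 2^-k, beta spends at most
   the time 2^-k / (q + 1) at distance less than 2 * 2^-k from 0 during any
   window of length 2 / (k + 1), as measured on arbitrarily fine grids. *)
Definition sparse {R : realType} (t0 : R) (N : nat) (beta : R -> R) :=
  forall q : nat, exists k0 : nat, forall k : nat, (k0 <= k)%N ->
    forall m : nat, exists2 n : nat, (m <= n)%N &
      few_hits t0 N q.+1%:R^-1 k n beta.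

(* [dl] is the signed distance from Z to the obstacle, B - Z for the equation;
   only its sign matters, as soon as |dl| >= eta. *)
Definition approx_solution {R : realType} (F1 F2 : R -> R)
    (t0 T eta rho : R) (dl Z : R -> R) :=
  forall u v : R, t0 <= u -> u <= v -> v <= T -> v - u <= rho ->
    (dl u <= - eta -> `|Z v - Z u - F1 (Z u) * (v - u)| <= eta * (v - u)) /\
    (eta <= dl u -> `|Z v - Z u - F2 (Z u) * (v - u)| <= eta * (v - u)).

Definition lip_on {R : realType} (a b L : R) (Z : R -> R) :=
  forall u v, a <= u -> u <= v -> v <= b -> `|Z v - Z u| <= L * (v - u).

(** The step bound is available only while [a i <= eps]. The induction carries the running total of
    the increments, which the last hypothesis keeps below [eps], so the bound is never lost. *)
Lemma discrete_growth {R : realType} (a : nat -> R) (bad : pred nat)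
    (eps c L : R) (l : nat) : 0 <= c -> 0 <= L ->
  (forall i, (i < l)%N -> a i <= eps ->
     a i.+1 <= a i + (if bad i then L else c)) ->
  a 0 + l%:R * c + L * (count bad (iota 0 l))%:R <= eps ->
  forall i, (i <= l)%N -> a i <= eps.
Proof.
move=> c0 L0 step tot.
suff H i : (i <= l)%N -> a i <= a 0 + i%:R * c + L * (count bad (iota 0 i))%:R.
  move=> i il; apply: le_trans (H _ il) _; apply: le_trans tot.
  rewrite lerD// ?lerD// ?ler_wpM2r// ?ler_nat// ler_wpM2l// ler_nat.
  by rewrite -(subnKC il) iotaD count_cat leq_addr.
elim: i => [|i IH] il; first by rewrite mul0r mulr0 !addr0.
have {}IH := IH (ltnW il).
have ai : a i <= eps.
  apply: le_trans IH _; apply: le_trans tot.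
  rewrite lerD// ?lerD// ?ler_wpM2r// ?ler_nat ?(ltnW il)// ler_wpM2l// ler_nat.
  by rewrite -(subnKC (ltnW il)) iotaD count_cat leq_addr.
apply: le_trans (step i il ai) _.
rewrite -addn1 iotaD count_cat natrD add0n /= addn0.
case: ifP => _ /=.
  rewrite natrD mulrDr mulrDl mul1r mulr1; lra.
rewrite natrD mulrDr mulrDl mul1r mulr0; lra.
Qed.

(** As [d1 u] and [d2 u] differ by at most [eps] and [|d1 u| >= 2 * eps], they have the same sign
    and size at least [eta]: both functions follow the same [F]. Per unit of time, the Lipschitz
    bound costs [M * eps] and the two approximation errors cost [2 * eta]. *)
Lemma approx_solutions_step {R : realType} (F1 F2 : R -> R)
    (M t0 T eta rho eps u v : R) (d1 d2 Z1 Z2 : R -> R) :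
  M.-lipschitz F1 -> M.-lipschitz F2 -> 0 <= M ->
  approx_solution F1 F2 t0 T eta rho d1 Z1 ->
  approx_solution F1 F2 t0 T eta rho d2 Z2 ->
  `|d1 u - d2 u| <= `|Z1 u - Z2 u| -> `|Z1 u - Z2 u| <= eps -> eta <= eps ->
  2 * eps <= `|d1 u| -> t0 <= u -> u <= v -> v <= T -> v - u <= rho ->
  `|Z1 v - Z2 v| <= `|Z1 u - Z2 u| + (M + 2) * eps * (v - u).
Proof.
move=> lF1 lF2 M0 H1 H2 dd Ze ee de t0u uv vT vu.
have [H11 H12] := H1 u v t0u uv vT vu.
have [H21 H22] := H2 u v t0u uv vT vu.
have vu0 : 0 <= v - u by rewrite subr_ge0.
have core (F : R -> R) : M.-lipschitz F ->
    `|Z1 v - Z1 u - F (Z1 u) * (v - u)| <= eta * (v - u) ->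
    `|Z2 v - Z2 u - F (Z2 u) * (v - u)| <= eta * (v - u) ->
    `|Z1 v - Z2 v| <= `|Z1 u - Z2 u| + (M + 2) * eps * (v - u).
  move=> lF G1 G2.
  have G3 : `|(F (Z1 u) - F (Z2 u)) * (v - u)| <= M * eps * (v - u).
    rewrite normrM (ger0_norm vu0) ler_wpM2r//.
    have := lF (Z1 u, Z2 u) (conj I I); rewrite /= => /le_trans; apply.
    by rewrite ler_wpM2l.
  have G4 : eta * (v - u) <= eps * (v - u) by rewrite ler_wpM2r.
  have -> : Z1 v - Z2 v = (Z1 u - Z2 u)
     + (F (Z1 u) - F (Z2 u)) * (v - u)
     + (Z1 v - Z1 u - F (Z1 u) * (v - u)) - (Z2 v - Z2 u - F (Z2 u) * (v - u)).
    by ring.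
  apply: le_trans (ler_normB _ _) _.
  apply: le_trans (lerD (ler_normD _ _) (lexx _)) _.
  apply: le_trans (lerD (lerD (ler_normD _ _) (lexx _)) (lexx _)) _.
  by lra.
have [d1n|d1p] := lerP (d1 u) 0.
  rewrite (ler0_norm d1n) in de.
  have : d2 u <= - eta.
    by move: (le_trans dd Ze); rewrite ler_norml => /andP[]; lra.
  have : d1 u <= - eta by lra.
  by move=> /H11 a1 /H21 a2; exact: core a1 a2.
rewrite (gtr0_norm d1p) in de.
have : eta <= d2 u.
  by move: (le_trans dd Ze); rewrite ler_norml => /andP[]; lra.
have : eta <= d1 u by lra.
by move=> /H12 a1 /H22 a2; exact: core a1 a2.
Qed.

Lemma nat_floor {R : realType} (x : R) :
  0 <= x -> exists i : nat, i%:R <= x < i.+1%:R.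
Proof. by move=> x0; exists (Num.trunc x); exact: truncn_itv. Qed.

Lemma eventually_invS_le {R : realType} (e : R) : 0 < e ->
  exists m : nat, forall n, (m <= n)%N -> n.+1%:R^-1 <= e.
Proof.
move=> e0; exists (Num.trunc e^-1) => n mn.
rewrite -(invrK e) lef_pV2 ?posrE ?invr_gt0//.
apply: ltW; apply: lt_le_trans (truncnS_gt _) _.
by rewrite ler_nat ltnS.
Qed.

(** The difference is followed along the ticks. Steps where [d1] is away from 0 cost [(M + 2) * eps]
    per unit of time, which is little over a duration [1 / (k + 1)]; the other steps cost [2 * L]
    per unit of time, but [few_hits] makes them rare. *)
Lemma comparison_stage {R : realType} (F1 F2 : R -> R) (M L th t0 eta rho s : R)
    (N k : nat) (d1 d2 Z1 Z2 : R -> R) :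
  M.-lipschitz F1 -> M.-lipschitz F2 -> 0 <= M -> 0 <= L -> 0 < rho ->
  lip_on t0 (t0 + N%:R) L Z1 -> lip_on t0 (t0 + N%:R) L Z2 ->
  approx_solution F1 F2 t0 (t0 + N%:R) eta rho d1 Z1 ->
  approx_solution F1 F2 t0 (t0 + N%:R) eta rho d2 Z2 ->
  (forall u, t0 <= u -> u <= t0 + N%:R -> `|d1 u - d2 u| <= `|Z1 u - Z2 u|) ->
  (forall m, exists2 n, (m <= n)%N & few_hits t0 N th k n d1) ->
  eta <= 2^-1 ^+ k -> 8 * (M + 2) <= k.+1%:R -> 16 * L * th <= 1 ->
  t0 <= s -> s + 2 <= t0 + N%:R -> `|Z1 s - Z2 s| <= 2^-1 ^+ k.+1 ->
  forall t, s <= t -> t <= s + k.+1%:R^-1 -> `|Z1 t - Z2 t| <= 2^-1 ^+ k.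
Proof.
move=> lF1 lF2 M0 L0 rho0 lZ1 lZ2 A1 A2 dd few ee kM Lth t0s sN gs t st tsk.
set eps : R := 2^-1 ^+ k in ee few *.
have eps0 : 0 < eps by rewrite exprn_gt0// invr_gt0.
have Lip u v : t0 <= u -> u <= v -> v <= t0 + N%:R ->
    `|Z1 v - Z2 v| <= `|Z1 u - Z2 u| + 2 * L * (v - u).
  move=> h1 h2 h3; have := lZ1 _ _ h1 h2 h3; have := lZ2 _ _ h1 h2 h3.
  have -> : Z1 v - Z2 v = (Z1 u - Z2 u) + (Z1 v - Z1 u) - (Z2 v - Z2 u) by ring.
  move=> a b; apply: le_trans (ler_normB _ _) _.
  by apply: le_trans (lerD (ler_normD _ _) (lexx _)) _; lra.
(* The mesh [h] will be below [rho], and [32 * L * h <= eps] bounds the growth [2 * L * h] in one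
   step by [eps / 16]; [L + 1] avoids a division by zero. *)
have [m Hm] : exists m : nat, forall n, (m <= n)%N ->
    n.+1%:R^-1 <= Num.min rho (eps / (32 * (L + 1))).
  apply: eventually_invS_le; rewrite lt_min rho0/= divr_gt0//.
  by rewrite mulr_gt0// ltr_wpDl.
have [n mn fh] := few m.
have := Hm n mn; rewrite le_min => /andP[nr ne].
have [K KE] : exists K : R, K = k.+1%:R by exists k.+1%:R.
have [n' nE] : exists n' : R, n' = n.+1%:R by exists n.+1%:R.
rewrite -KE in kM tsk; rewrite -nE in nr ne.
have K0 : 0 < K by rewrite KE ltr0n.
have K1 : 1 <= K by rewrite KE ler1n.
have n'0 : 0 < n' by rewrite nE ltr0n.
have [h hE] : exists h : R, h = (K * n')^-1 by exists (K * n')^-1.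
have h0 : 0 < h by rewrite hE invr_gt0 mulr_gt0.
have hn : h * n' = K^-1 by rewrite hE invfM -mulrA mulVf ?mulr1// gt_eqF.
have hK : h * K = n'^-1 by rewrite hE invfM mulrAC mulVf ?mul1r// gt_eqF.
have hn1 : h <= n'^-1.
  by rewrite -hK ler_peMr// ltW.
have n1 : n'^-1 <= 1 by rewrite invf_le1// nE ler1n.
have K1' : K^-1 <= 1 by rewrite invf_le1.
have Lh : 2 * L * h <= eps / 16.
  have : h * (32 * (L + 1)) <= eps.
    by rewrite -ler_pdivlMr; [exact: le_trans hn1 ne | rewrite mulr_gt0// ltr_wpDl].
  by nra.
pose tk := tick t0 (k.+1 * n.+1).
have tkE i : tk i = t0 + i%:R * h by rewrite /tk /tick natrM hE KE nE.
have tkS i : tk i.+1 = tk i + h by rewrite !tkE -addn1 natrD; ring.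
have [i0 /andP[i01 i02]] := nat_floor ((s - t0) / h) (divr_ge0 (eqbRL (subr_ge0 _ _) t0s) (ltW h0)).
rewrite ler_pdivlMr// in i01; rewrite ltr_pdivrMr// in i02.
have tk1 : tk i0 <= s by rewrite tkE; lra.
have tk2 : s < tk i0.+1 by rewrite tkE; lra.
have tki i : tk (i0.+1 + i)%N = tk i0.+1 + i%:R * h.
  by rewrite !tkE natrD; ring.
pose a i := `|Z1 (tk (i0.+1 + i)%N) - Z2 (tk (i0.+1 + i)%N)|.
pose bad i := `|d1 (tk (i0.+1 + i)%N)| < 2 * eps.
have irange (i : nat) : (i <= n.+1)%N -> tk (i0.+1 + i)%N <= s + 2.
  move=> il; rewrite tki; have := tkS i0.
  have : i%:R * h <= h * n' by rewrite mulrC ler_wpM2l ?(ltW h0)// nE ler_nat.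
  rewrite hn; have := le_trans hn1 n1; lra.
have irange0 (i : nat) : t0 <= tk (i0.+1 + i)%N.
  rewrite tki; have : 0 <= i%:R * h by rewrite mulr_ge0// ltW.
  by lra.
have hrho : h <= rho by exact: le_trans hn1 nr.
(* The window number [i0 / (n + 1)] contains the [n + 1] ticks following [i0]: the remainder of [i0]
   is less than [n + 1] and the window has [2 * (n + 1)] ticks. *)
have cnt : (count bad (iota 0 n.+1))%:R <= th * eps * (K * n').
  have jN : ((i0 %/ n.+1).+2 <= N * k.+1)%N.
    rewrite -(ler_nat R) -addn2 natrD [(N * _)%:R]natrM.
    rewrite -lerBrDr -(ler_pM2r n'0).
    apply: (@le_trans _ _ i0%:R); first by rewrite nE -natrM ler_nat leq_divM.
    rewrite -(ler_pM2r h0); apply: le_trans i01 _.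
    have -> : (N%:R * k.+1%:R - 2) * n' * h = (N%:R * K - 2) * (h * n').
      by rewrite KE; ring.
    rewrite hn mulrBl mulfK ?gt_eqF//.
    have := K1'; lra.
  have := fh _ jN; rewrite natrM -KE -nE; apply: le_trans.
  rewrite ler_nat /hits.
  have -> : count bad (iota 0 n.+1) =
     count (fun i => `|d1 (tick t0 (k.+1 * n.+1) i)| < 2 * 2^-1 ^+ k) (iota i0.+1 n.+1).
    by rewrite -[in RHS](addn0 i0.+1) iotaDl count_map.
  have e1 : (i0.+1 = (i0 %/ n.+1 * n.+1).+1 + i0 %% n.+1)%N by rewrite addSn -divn_eq.
  have e2 : (2 * n.+1 = i0 %% n.+1 + (n.+1 + (n.+1 - i0 %% n.+1)))%N.
    by move: (ltn_pmod i0 (ltn0Sn n)); move: (i0 %% n.+1)%N => r; clear; lia.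
  rewrite e2 iotaD iotaD !count_cat -e1.
  by rewrite addnCA leq_addr.
(* Budget: [eps / 2 + eps / 16] at the first tick after [s], then [eps / 8] for the good steps and
   [eps / 8] for the bad ones. The margin [eps / 16] pays for going from a tick to [t]. *)
have a_eps : forall i, (i <= n.+1)%N -> a i <= eps - eps / 16.
  apply: (@discrete_growth _ a bad _ ((M + 2) * eps * h) (2 * L * h)).
  - by rewrite mulr_ge0// ?ltW// mulr_gt0// ltr_wpDl.
  - by rewrite mulr_ge0 ?mulr_ge0// ltW.
  - move=> i il ai.
    have e1 : tk (i0.+1 + i.+1)%N = tk (i0.+1 + i)%N + h by rewrite addnS tkS.
    have e2 := irange i.+1 il.
    have e3 := irange0 i.
    have -> : h = tk (i0.+1 + i.+1)%N - tk (i0.+1 + i)%N by rewrite e1; ring.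
    case: ifPn => [_|].
      by apply: Lip => //; lra.
    rewrite -leNgt => nb.
    apply: (approx_solutions_step F1 F2 M t0 (t0 + N%:R) eta rho eps _ _ d1 d2 Z1 Z2) => //.
    + by apply: dd => //; lra.
    + by rewrite -/(a i); lra.
    + by lra.
    + by lra.
    + by lra.
  - have e0 : a 0%N <= eps / 2 + 2 * L * h.
      rewrite /a addn0; have := Lip s (tk i0.+1) t0s (ltW tk2).
      have e4 := irange 0%N isT; rewrite addn0 in e4.
      move=> /(_ (le_trans e4 sN)) /le_trans; apply; rewrite lerD//.
        by apply: le_trans gs _; rewrite exprS mulrC.
      by rewrite ler_wpM2l ?mulr_ge0//; have := tkS i0; lra.
    have e1 : n.+1%:R * ((M + 2) * eps * h) <= eps / 8.
      rewrite -nE (_ : _ * _ = (M + 2) * eps * (h * n')); last by ring.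
      rewrite hn ler_pdivrMr// ; have : 0 <= eps * (K - 8 * (M + 2)).
        by rewrite (mulr_ge0 (ltW eps0))// subr_ge0.
      by lra.
    have e2 : 2 * L * h * (count bad (iota 0 n.+1))%:R <= eps / 8.
      apply: (@le_trans _ _ (2 * L * h * (th * eps * (K * n')))).
        by rewrite ler_wpM2l// mulr_ge0 ?mulr_ge0// ltW.
      have -> : 2 * L * h * (th * eps * (K * n')) = 2 * L * th * eps * ((K * n') * h).
        by ring.
      rewrite hE divff ?gt_eqF ?mulr_gt0// mulr1.
      have : 0 <= eps * (1 - 16 * L * th) by rewrite (mulr_ge0 (ltW eps0))// subr_ge0.
      by lra.
    by lra.
have tN : t <= t0 + N%:R by lra.
have [ttk|tkt] := ltrP t (tk i0.+1).
  have := Lip s t t0s st tN.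
  have : 2 * L * (t - s) <= 2 * L * h.
    by rewrite ler_wpM2l ?mulr_ge0//; have := tkS i0; lra.
  have : 2^-1 ^+ k.+1 = eps / 2 by rewrite exprS mulrC.
  by lra.
have [i /andP[i1 i2]] := nat_floor ((t - tk i0.+1) / h) (divr_ge0 (eqbRL (subr_ge0 _ _) tkt) (ltW h0)).
rewrite ler_pdivlMr// in i1; rewrite ltr_pdivrMr// in i2.
have il : (i <= n.+1)%N.
  rewrite -(ler_nat R) -(ler_pM2r h0); apply: le_trans i1 _.
  by rewrite -nE [n' * h]mulrC hn; lra.
have := a_eps i il; rewrite /a.
have i1' : tk (i0.+1 + i)%N <= t by rewrite tki; lra.
have := Lip _ t (irange0 i) i1' tN.
have : 2 * L * (t - tk (i0.+1 + i)%N) <= 2 * L * h.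
  rewrite ler_wpM2l ?mulr_ge0// tki; move: i2; rewrite -natr1 mulrDl mul1r; lra.
by lra.
Qed.

Lemma eventually_half_pow_le {R : realType} (e : R) : 0 < e ->
  exists m : nat, forall k, (m <= k)%N -> 2^-1 ^+ k <= e.
Proof.
move=> /eventually_invS_le[m Hm]; exists m => k mk; apply: le_trans (Hm k mk).
rewrite exprVn lef_pV2 ?posrE ?exprn_gt0// -natrX ler_nat; exact: ltn_expl.
Qed.

Lemma harmonic_tail_unbounded {R : realType} (k : nat) (C : R) :
  exists2 K : nat, (k <= K)%N & C <= \sum_(k <= i < K) i.+1%:R^-1.
Proof.
apply: contrapT => H; apply: (@dvg_harmonic R).
apply: nondecreasing_is_cvgn.
  by apply: nondecreasing_series => i _ _; exact: harmonic_ge0.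
exists (C + \sum_(0 <= i < k) i.+1%:R^-1) => _ [K _ <-].
have [kK|/ltnW Kk] := leqP k K.
  rewrite /series/= (big_cat_nat _ kK)//= [C + _]addrC lerD2l leNgt.
  by apply/negP => CK; apply: H; exists K => //; exact: ltW.
rewrite /series/= -[leLHS]add0r lerD//.
  rewrite leNgt; apply/negP => C0; apply: H; exists k => //.
  by rewrite big_geq// ltW.
rewrite (big_cat_nat _ Kk)//= lerDl sumr_ge0//.
Qed.

(* Osgood's argument: |Z1 - Z2| needs a time at least 1 / (k + 1) to grow from
   2^-(k + 1) to 2^-k, and the harmonic series diverges. *)
Lemma comparison {R : realType} (F1 F2 : R -> R) (M L t0 e : R) (N : nat)
    (d1 : R -> R) :
  M.-lipschitz F1 -> M.-lipschitz F2 -> 0 <= M -> 0 <= L -> 0 < e ->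
  sparse t0 N d1 ->
  exists2 eta : R, 0 < eta & forall (rho : R) (d2 Z1 Z2 : R -> R), 0 < rho ->
  lip_on t0 (t0 + N%:R) L Z1 -> lip_on t0 (t0 + N%:R) L Z2 ->
  approx_solution F1 F2 t0 (t0 + N%:R) eta rho d1 Z1 ->
  approx_solution F1 F2 t0 (t0 + N%:R) eta rho d2 Z2 ->
  (forall u, t0 <= u -> u <= t0 + N%:R -> `|d1 u - d2 u| <= `|Z1 u - Z2 u|) ->
  Z1 t0 = Z2 t0 ->
  forall t, t0 <= t -> t + 2 <= t0 + N%:R -> `|Z1 t - Z2 t| <= e.
Proof.
move=> lF1 lF2 M0 L0 e0 sp.
have [q Hq] : exists q : nat, 16 * L * q.+1%:R^-1 <= 1.
  have [q Hq] := @eventually_invS_le R (16 * (L + 1))^-1 ltac:(rewrite invr_gt0 mulr_gt0// ltr_wpDl//).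
  exists q; have := Hq q (leqnn q) => {}Hq.
  have /le_trans -> // : 16 * L * q.+1%:R^-1 <= 16 * L * (16 * (L + 1))^-1.
    by rewrite ler_wpM2l// mulr_ge0.
  rewrite ler_pdivrMr ?mul1r; last by rewrite mulr_gt0// ltr_wpDl.
  by rewrite ler_wpM2l// lerDl.
have [k0 Hk0] := sp q.
have [k2 Hk2] := eventually_half_pow_le e e0.
(* From scale [k1] on, [d1] has few hits with constant [1 / (q + 1)], the good steps fit in their
   budget, and [2^-k <= e]. *)
pose k1 := maxn (maxn k0 k2) (Num.trunc (8 * (M + 2))).
have [K k1K HK] := @harmonic_tail_unbounded R k1 N%:R.
(* The stages [k1, ..., K - 1] together last at least [N], and stage [k] asks for an accuracy
   [eta <= 2^-k]. *)
exists (2^-1 ^+ K); first by rewrite exprn_gt0// invr_gt0.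
move=> rho d2 Z1 Z2 rho0 lZ1 lZ2 A1 A2 dd Z12.
(* The scale is coarsened from [K], where only the time [t0] is covered, to [k1]; stage [k] adds
   [1 / (k + 1)] to the time covered. *)
have main : forall r k, (k + r = K)%N -> (k1 <= k)%N ->
    forall t, t0 <= t -> t <= t0 + \sum_(k <= i < K) i.+1%:R^-1 ->
      t + 2 <= t0 + N%:R -> `|Z1 t - Z2 t| <= 2^-1 ^+ k.
  elim=> [|r IH] k kr k1k t t0t.
    rewrite big_geq ?addr0 -?kr ?addn0// => tt0 _.
    have -> : t = t0 by apply/eqP; rewrite eq_le tt0.
    by rewrite Z12 subrr normr0 exprn_ge0// invr_ge0.
  have kK : (k < K)%N by rewrite -kr addnS ltnS leq_addr.
  rewrite big_ltn//; set S := \sum_(_ <= _ < _) _ => tS tN.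
  have {}IH := IH k.+1 ltac:(rewrite -kr addSnnS//) (leqW k1k).
  have S0 : 0 <= S by rewrite sumr_ge0// => i _; rewrite invr_ge0.
  have [ts|st] := lerP t (t0 + S).
    apply: le_trans (IH t t0t ts tN) _; rewrite exprS.
    by rewrite ler_piMl ?exprn_ge0 ?invr_ge0// invf_le1// ler1n.
  have t0s : t0 <= t0 + S by rewrite lerDl.
  have sN : t0 + S + 2 <= t0 + N%:R.
    by apply: le_trans tN; rewrite lerD2r ltW.
  apply: (comparison_stage F1 F2 M L q.+1%:R^-1 t0 (2^-1 ^+ K) rho (t0 + S) N k d1 d2 Z1 Z2) => //.
  - by apply: Hk0; apply: leq_trans k1k; rewrite /k1 -maxnA leq_maxl.
  - by rewrite -kr exprD ler_piMr ?exprn_ge0 ?invr_ge0// exprn_ile1// ?invr_ge0// invf_le1// ler1n.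
  - apply: ltW; apply: lt_le_trans (truncnS_gt _) _.
    by rewrite ler_nat ltnS; apply: leq_trans k1k; rewrite /k1 leq_maxr.
  - exact: IH.
  - exact: ltW.
  - by apply: le_trans tS _; rewrite addrAC addrA.
move=> t t0t tN; apply: le_trans (Hk2 k1 _).
  apply: (main (K - k1)%N k1) => //; first by rewrite subnKC.
  apply: (@le_trans _ _ (t + 2)); first by rewrite lerDl.
  by apply: le_trans tN _; rewrite lerD2l.
by rewrite /k1 !leq_max leqnn orbT.
Qed.

(** * Euler schemes *)

Lemma dist_le_continuous {R : realType} (f : R -> R) (L : R) : 0 <= L ->
  (forall u v, `|f v - f u| <= L * `|v - u|) -> continuous f.
Proof.
move=> L0 lf t; apply/cvgrPdist_le => e e0.
apply/nbhs_ballP; exists (e / (L + 1)) => /=; first by rewrite divr_gt0// ltr_wpDl.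
move=> s; rewrite /ball/= ltr_pdivlMr ?ltr_wpDl// => ts.
apply: le_trans (lf _ _) _; apply: le_trans (ltW ts).
by rewrite mulrC ler_wpM2l// lerDl.
Qed.

(** Heine's theorem: points [x'] within [r / 2] of [x], and [y] within [d < r / 2] of [x'], all lie
    within [r] of [x]; compactness makes the choice of [d] uniform. *)
Lemma segment_uniform_continuity {R : realType} (a b : R) (f : R -> R) :
  {within `[a, b], continuous f} -> forall e : R, 0 < e ->
  exists2 d : R, 0 < d & forall x y, a <= x <= b -> a <= y <= b ->
    `|x - y| <= d -> `|f x - f y| <= e.
Proof.
move=> /subspace_continuousP cf e e0.
have := @segment_compact R a b.
move=> /compact_near_coveringP/near_covering_withinP.
move=> /(_ R (0^'+) (fun d x => forall y, a <= y <= b -> `|x - y| <= d ->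
  `|f x - f y| <= e) _).
case.
  move=> x /= xab.
  have /cvgrPdist_lt/(_ (e / 2) ltac:(rewrite divr_gt0//)) := cf x xab.
  rewrite near_withinE => /nbhs_ballP[r/= r0 Hr].
  exists (ball x (r / 2), [set d | d < r / 2]) => /=.
    split; first by apply: nbhsx_ballx; rewrite divr_gt0.
    by apply: nbhs_right_lt; rewrite divr_gt0.
  move=> [x' d]/= [xx' dr] x'ab y yab x'y.
  rewrite /ball/= in xx'.
  have h1 : `|f x - f x'| < e / 2.
    apply: Hr => //; rewrite /ball/=; apply: lt_le_trans xx' _.
    by rewrite ler_pdivrMr// ler_peMr ?ler1n// ltW.
  have h2 : `|f x - f y| < e / 2.
    apply: Hr; last by rewrite /= in_itv.
    rewrite /ball/=; have -> : x - y = (x - x') + (x' - y) by ring.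
    apply: le_lt_trans (ler_normD _ _) _; lra.
  have -> : f x' - f y = (f x - f y) - (f x - f x') by ring.
  apply: le_trans (ler_normB _ _) _; lra.
move=> d /= d0 Hd; exists (d / 2); first by rewrite divr_gt0.
move=> x y xab yab xy; apply: (Hd (d / 2)) => //=.
- rewrite sub0r normrN gtr0_norm ?divr_gt0//.
  by rewrite ltr_pdivrMr// ltr_pMr// ltr1n.
- by rewrite divr_gt0.
Qed.

(* The slope is F1 below the obstacle w < psi x: psi = id gives the Euler scheme
   of the equation, and psi = cst lvl the scheme of the equation in which the
   sign of B - X is prescribed to be that of w - lvl. *)
Section euler.
Context {R : realType} (F1 F2 psi : R -> R) (t0 x0 : R) (m : nat) (w : R -> R).

Definition slope (i : nat) (x : R) : R :=
  if w (tick t0 m i) < psi x then F1 x else F2 x.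

Fixpoint euler_state (i : nat) : R :=
  if i is j.+1 then euler_state j + m%:R^-1 * slope j (euler_state j) else x0.

(* time spent before [t] in the cell [tick j, tick (j + 1)] *)
Definition cell_time (j : nat) (t : R) : R :=
  Num.min t (tick t0 m j.+1) - Num.min t (tick t0 m j).

Definition euler_upto (J : nat) (t : R) : R :=
  x0 + \sum_(0 <= j < J) cell_time j t * slope j (euler_state j).

(** For [m > 0] the omitted cells start after [t] and contribute nothing ([euler_uptoE]). For
    [t < t0] the truncation is 0 and the value is [x0]. *)
Definition euler (t : R) : R := euler_upto (Num.trunc ((t - t0) * m%:R)).+1 t.

Hypothesis m0 : (0 < m)%N.

Let m0' : 0 < m%:R :> R. Proof. by rewrite ltr0n. Qed.

Lemma tickS i : tick t0 m i.+1 = tick t0 m i + m%:R^-1.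
Proof. by rewrite /tick -natr1 mulrDl mul1r addrA. Qed.

Lemma tick_le i j : (i <= j)%N -> tick t0 m i <= tick t0 m j.
Proof. by move=> ij; rewrite /tick lerD2l ler_pM2r ?invr_gt0// ler_nat. Qed.

Lemma tick_ge i : t0 <= tick t0 m i.
Proof. by rewrite /tick lerDl divr_ge0. Qed.

Lemma cell_time_homo j u v : u <= v -> cell_time j u <= cell_time j v.
Proof.
move=> uv; rewrite /cell_time; have := tickS j.
have : 0 < m%:R^-1 :> R by rewrite invr_gt0.
move: (tick t0 m j) (tick t0 m j.+1) (m%:R^-1) => a b h h0 ->; rewrite !minEle.
by repeat case: ifPn; rewrite -?ltNge => *; lra.
Qed.

Lemma cell_time_before j t : t <= tick t0 m j -> cell_time j t = 0.
Proof.
move=> tj; rewrite /cell_time !min_l ?subrr//.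
exact: le_trans tj (tick_le _ _ (leqnSn j)).
Qed.

Lemma cell_time_after j t : tick t0 m j.+1 <= t -> cell_time j t = m%:R^-1.
Proof.
move=> tj; rewrite /cell_time !min_r//; first by rewrite tickS; ring.
exact: le_trans (tick_le _ _ (leqnSn j)) tj.
Qed.

Lemma sum_cell_time J t :
  \sum_(0 <= j < J) cell_time j t = Num.min t (tick t0 m J) - Num.min t t0.
Proof.
by rewrite telescope_sumr// /tick mul0r addr0.
Qed.

Lemma euler_uptoE J t : t <= tick t0 m J -> euler t = euler_upto J t.
Proof.
have H J1 J2 : (J1 <= J2)%N -> t <= tick t0 m J1 ->
    euler_upto J2 t = euler_upto J1 t.
  move=> J12 tJ; rewrite /euler_upto (big_cat_nat _ J12)//=.
  have -> : \sum_(J1 <= j < J2) cell_time j t * slope j (euler_state j) = 0.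
    rewrite big_nat big1// => j /andP[Jj _].
    by rewrite cell_time_before ?mul0r// (le_trans tJ)// tick_le.
  by rewrite addr0.
move=> tJ; rewrite /euler; set K := (_.+1)%N.
have tK : t <= tick t0 m K.
  rewrite /tick -lerBlDl ler_pdivlMr//; apply: ltW; exact: truncnS_gt.
by have [/H|/ltnW/H] := leqP J K; move=> ->.
Qed.

(** The increment is a sum of slopes with nonnegative weights of total [v - u], and only the cells
    meeting the interval from [u] to [v] have a nonzero weight. *)
Lemma euler_upto_increment J u v c e : t0 <= u -> u <= v -> v <= tick t0 m J ->
  (forall j, tick t0 m j < v -> u < tick t0 m j.+1 ->
     `|slope j (euler_state j) - c| <= e) ->
  `|euler_upto J v - euler_upto J u - c * (v - u)| <= e * (v - u).
Proof.
move=> t0u uv vJ H.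
have t0v := le_trans t0u uv.
have vuE : v - u = \sum_(0 <= j < J) (cell_time j v - cell_time j u).
  rewrite sumrB !sum_cell_time (min_l vJ) (min_l (le_trans uv vJ)).
  by rewrite !min_r//; ring.
have -> : euler_upto J v - euler_upto J u - c * (v - u) =
    \sum_(0 <= j < J) (cell_time j v - cell_time j u) *
       (slope j (euler_state j) - c).
  rewrite vuE mulr_sumr /euler_upto opprD addrACA subrr add0r.
  by rewrite -!sumrB; apply: eq_bigr => j _; ring.
rewrite vuE mulr_sumr.
apply: le_trans (ler_norm_sum _ _ _) _; apply: ler_sum => j _.
have c0 : 0 <= cell_time j v - cell_time j u by rewrite subr_ge0 cell_time_homo.
rewrite normrM (ger0_norm c0) mulrC.
have [vj|jv] := lerP v (tick t0 m j).
  by rewrite !cell_time_before ?subrr ?mulr0// (le_trans uv).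
have [ju|uj] := lerP (tick t0 m j.+1) u.
  by rewrite !cell_time_after ?subrr ?mulr0// (le_trans ju).
by rewrite ler_wpM2r// H.
Qed.

Lemma tick_above (t : R) : exists J, t <= tick t0 m J.
Proof.
exists (Num.trunc ((t - t0) * m%:R)).+1.
rewrite /tick -lerBlDl ler_pdivlMr//; apply: ltW; exact: truncnS_gt.
Qed.

Lemma euler_increment u v c e : t0 <= u -> u <= v ->
  (forall j, tick t0 m j < v -> u < tick t0 m j.+1 ->
     `|slope j (euler_state j) - c| <= e) ->
  `|euler v - euler u - c * (v - u)| <= e * (v - u).
Proof.
move=> t0u uv H; have [J vJ] := tick_above v.
rewrite (euler_uptoE J v)// (euler_uptoE J u) ?(le_trans uv)//.
exact: euler_upto_increment.
Qed.

Lemma euler_start t : t <= t0 -> euler t = x0.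
Proof.
move=> tt0; rewrite (euler_uptoE 0%N) ?/tick ?mul0r ?addr0//.
by rewrite /euler_upto big_geq// addr0.
Qed.

Lemma euler_tick i : euler (tick t0 m i) = euler_state i.
Proof.
rewrite (euler_uptoE i)// /euler_upto.
have -> : euler_state i = x0 + \sum_(0 <= j < i) m%:R^-1 * slope j (euler_state j).
  elim: i => [|i IH] /=; first by rewrite big_geq// addr0.
  by rewrite big_nat_recr//= addrA -IH.
congr (_ + _); apply: eq_big_nat => j /andP[_ ji].
by rewrite cell_time_after// tick_le.
Qed.

Lemma euler_lipschitz M : (forall x, `|F1 x| <= M) -> (forall x, `|F2 x| <= M) ->
  forall u v, u <= v -> `|euler v - euler u| <= M * (v - u).
Proof.
move=> bF1 bF2 u v uv; have M0 : 0 <= M := le_trans (normr_ge0 _) (bF1 0).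
have core u' : t0 <= u' -> u' <= v -> `|euler v - euler u'| <= M * (v - u').
  move=> h1 h2; have := euler_increment u' v 0 M h1 h2.
  rewrite mul0r subr0; apply => j _ _; rewrite subr0 /slope.
  by case: ifP.
have [t0u|ut0] := lerP t0 u; first exact: core.
rewrite (euler_start u (ltW ut0)); have [vt0|t0v] := lerP v t0.
  by rewrite euler_start// subrr normr0 mulr_ge0// subr_ge0.
rewrite -(euler_start t0)//; apply: le_trans (core t0 _ (ltW t0v)) _ => //.
by rewrite ler_wpM2l// lerD2l lerN2 ltW.
Qed.

End euler.

(** If [w - psi (euler ..)] has size at least [eta] at [u], its sign is the same at all ticks within
    [rho] of [u], since [w] and the scheme each move by at most [eta / 4]. All cells between [u] and
    [v] then use the same [F], at nearby values. *)
Lemma euler_approx_solution {R : realType} (F1 F2 psi : R -> R) (t0 x0 T M : R)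
    (w : R -> R) :
  (forall x, `|F1 x| <= M) -> (forall x, `|F2 x| <= M) ->
  M.-lipschitz F1 -> M.-lipschitz F2 ->
  (forall x y, `|psi x - psi y| <= `|x - y|) ->
  {within `[t0, T], continuous w} -> forall eta, 0 < eta ->
  exists2 rho, 0 < rho & exists n0, forall n, (n0 <= n)%N ->
    approx_solution F1 F2 t0 T eta rho
      (fun t => w t - psi (euler F1 F2 psi t0 x0 n.+1 w t))
      (euler F1 F2 psi t0 x0 n.+1 w).
Proof.
move=> bF1 bF2 lF1 lF2 lpsi cw eta eta0.
have M0 : 0 <= M := le_trans (normr_ge0 _) (bF1 0).
have [d d0 Hd] := segment_uniform_continuity t0 T w cw (eta / 4) ltac:(rewrite divr_gt0//).
have M1 : 0 < M + 1 by rewrite ltr_wpDl.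
(* One condition gives both [M * r <= eta / 4], for the sign, and [M * (M * r) <= eta], for the
   slope. *)
have [r [r0 rd r4]] : exists r, [/\ 0 < r, r <= d & r * (4 * (M + 1) * (M + 1)) <= eta].
  exists (Num.min d (eta / (4 * (M + 1) * (M + 1)))); split.
  - by rewrite lt_min d0 divr_gt0 ?mulr_gt0.
  - by rewrite ge_min lexx.
  - by rewrite -ler_pdivlMr ?mulr_gt0// ge_min lexx orbT.
exists r => //; have [n0 Hn0] := eventually_invS_le r r0.
exists n0 => n nn0; set E := euler _ _ _ _ _ _ _ => u v t0u uv vT vur.
have r1 : M * r <= eta / 4.
  have : 0 <= r * M by rewrite mulr_ge0// ltW.
  have : 0 <= r * M * M by rewrite mulr_ge0 ?mulr_ge0// ltW.
  have : 0 <= r by exact: ltW.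
  by move: r4; lra.
have r2 : M * (M * r) <= eta.
  have : 0 <= r * M by rewrite mulr_ge0// ltW.
  have : 0 <= r * M * M by rewrite mulr_ge0 ?mulr_ge0// ltW.
  have : 0 <= r by exact: ltW.
  by move: r4; lra.
have LipE a b : `|E b - E a| <= M * `|b - a|.
  have [ab|/ltW ba] := lerP a b.
    exact: euler_lipschitz.
  by rewrite distrC; exact: euler_lipschitz.
(* The cell containing [u] may start before [u], but by at most the mesh, which is at most [r]. *)
have near j : tick t0 n.+1 j < v -> u < tick t0 n.+1 j.+1 ->
    `|E (tick t0 n.+1 j) - E u| <= M * r /\ `|w (tick t0 n.+1 j) - w u| <= eta / 4.
  move=> jv uj; have := Hn0 n nn0; rewrite tickS in uj => hr.
  have ju : `|tick t0 n.+1 j - u| <= r.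
    move: hr uj jv vur; move: (n.+1%:R^-1) (tick _ _ _) => h a.
    by rewrite ler_norml => *; apply/andP; split; lra.
  split; first by apply: le_trans (LipE _ _) _; rewrite ler_wpM2l.
  apply: Hd; last exact: le_trans ju rd.
    by rewrite tick_ge (le_trans (ltW jv)).
  by rewrite t0u (le_trans uv).
have pn j : `|E (tick t0 n.+1 j) - E u| <= M * r ->
    `|psi (E (tick t0 n.+1 j)) - psi (E u)| <= eta / 4.
  by move=> h; apply: le_trans (lpsi _ _) _; exact: le_trans h r1.
have fin (F : R -> R) j : M.-lipschitz F -> `|E (tick t0 n.+1 j) - E u| <= M * r ->
    `|F (E (tick t0 n.+1 j)) - F (E u)| <= eta.
  move=> lF h; have := lF (E (tick t0 n.+1 j), E u) (conj I I).
  by move=> /= /le_trans; apply; apply: le_trans r2; rewrite ler_wpM2l.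
split => Hu; apply: euler_increment => // j jv uj;
  have [h1 h2] := near j jv uj; rewrite /slope -(euler_tick F1 F2 psi t0 x0) -/E//.
  case: ifPn => [_|]; first exact: fin.
  by have := pn j h1; move: h2 Hu; rewrite -leNgt !ler_norml; lra.
case: ifPn => [|_]; last exact: fin.
by have := pn j h1; move: h2 Hu; rewrite !ler_norml; lra.
Qed.

(** * Approximate and exact solutions *)

Lemma lip_on_continuous {R : realType} (a b L : R) (Z : R -> R) :
  lip_on a b L Z -> {within `[a, b], continuous Z}.
Proof.
move=> lZ; apply/subspace_continuousP => x /=; rewrite in_itv/= => /andP[ax xb].
apply/cvgrPdist_le => e e0; rewrite near_withinE.
apply/nbhs_ballP; exists (e / (`|L| + 1)) => /=.
  by rewrite divr_gt0// ltr_wpDl.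
move=> y; rewrite /ball/= ltr_pdivlMr ?ltr_wpDl// => xy.
rewrite in_itv/= => /andP[ay yb].
have xL : L * `|x - y| <= e.
  apply: le_trans (ltW xy); rewrite mulrC ler_wpM2l//.
  by apply: le_trans (ler_norm _) _; rewrite lerDl.
move: xL; have [xy'|/ltW xy'] := lerP x y => xL.
  by rewrite distrC (le_trans (lZ _ _ ax xy' yb)).
exact: le_trans (lZ _ _ ay xy' xb) xL.
Qed.

Lemma has_derivative_within_is_derive {R : realType} (t0 t l : R) (f : R -> R) :
  t0 < t -> has_derivative_within (timeline t0) f t l -> is_derive t 1 f l.
Proof.
move=> t0t H.
suff H' : (fun h => h^-1 *: (f (h *: 1 + t) - f t)) @ 0^' --> l.
  apply: DeriveDef; first by apply/cvg_ex; exists l.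
  exact: cvg_lim H'.
apply/cvgrPdist_le => e e0.
move/cvgrPdist_le : H => /(_ e e0).
rewrite !near_withinE.
move=> /nbhs_ballP[r/= r0 Hr].
apply/nbhs_ballP; exists (Num.min r (t - t0)) => /=.
  by rewrite lt_min r0 subr_gt0.
move=> h; rewrite /ball/= sub0r normrN lt_min => /andP[hr ht] h0.
have := Hr (h *: 1 + t); rewrite /ball/= opprD addrCA subrr addr0 normrN.
have -> : h *: (1 : R) = h by rewrite /GRing.scale/= mulr1.
rewrite -(addrA h) subrr addr0.
rewrite [X in `|l - X|]mulrC; apply => //.
  by rewrite -subr_eq0 -addrA subrr addr0.
rewrite /timeline/= in_itv/= andbT.
have : - h <= `|h| by rewrite -normrN ler_norm.
lra.
Qed.

Lemma lipschitz_lip_on {R : realType} (t0 : R) (X : R -> R) :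
  [lipschitz X t | t in timeline t0] ->
  exists2 L, 0 <= L & forall T, lip_on t0 T L X.
Proof.
move=> /pinfty_ex_gt0[L L0 HL]; exists L; first exact: ltW.
move=> T u v t0u uv vT; have := HL (v, u) => /=.
rewrite (ger0_norm (eqbRL (subr_ge0 _ _) uv)); apply.
by rewrite /timeline/= !in_itv/= !andbT t0u (le_trans t0u).
Qed.

(** When [b - X] has size at least [eta] at [u], neither [b] nor [X] moves enough within [rho] to
    change its sign: [X] obeys the same [F] up to [v], and the mean value theorem applies. *)
Lemma lipschitz_solution_approx {R : realType} (F1 F2 b X : R -> R)
    (M t0 x0 T : R) : 0 <= M ->
  M.-lipschitz F1 -> M.-lipschitz F2 -> {within `[t0, T], continuous b} ->
  lipschitz_solution F1 F2 t0 x0 b X -> forall eta, 0 < eta ->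
  exists2 rho, 0 < rho &
    approx_solution F1 F2 t0 T eta rho (fun t => b t - X t) X.
Proof.
move=> M0 lF1 lF2 cb [/lipschitz_lip_on[L L0 lX] _ solX] eta eta0.
have [d d0 Hd] := segment_uniform_continuity t0 T b cb (eta / 4) ltac:(rewrite divr_gt0//).
have [r [r0 rd r1 r2]] : exists r, [/\ 0 < r, r <= d, L * r <= eta / 4 & M * (L * r) <= eta].
  exists (Num.min d (Num.min (eta / 4 / (L + 1)) (eta / (M * L + 1)))); split.
  - by rewrite !lt_min d0 !divr_gt0// ltr_wpDl// mulr_ge0.
  - by rewrite ge_min lexx.
  - apply: (@le_trans _ _ (L * (eta / 4 / (L + 1)))).
      by rewrite ler_wpM2l// !ge_min lexx orbT.
    rewrite mulrA ler_pdivrMr ?ltr_wpDl// mulrC ler_wpM2l ?lerDl// divr_ge0// ltW//.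
  - rewrite mulrA; apply: (@le_trans _ _ (M * L * (eta / (M * L + 1)))).
      by rewrite ler_wpM2l ?mulr_ge0// !ge_min lexx !orbT.
    have ML : 0 <= M * L by rewrite mulr_ge0.
    by rewrite mulrA ler_pdivrMr ?ltr_wpDl// mulrC ler_wpM2l ?lerDl// ltW.
exists r => // u v t0u uv vT vur.
have near s : u <= s -> s <= v -> `|b s - b u| <= eta / 4 /\ `|X s - X u| <= L * r.
  move=> us sv; split.
    apply: Hd; rewrite ?t0u ?(le_trans t0u us) ?(le_trans sv)// ?(le_trans uv)//.
    by rewrite ger0_norm ?subr_ge0//; lra.
  apply: le_trans (lX T _ _ t0u us (le_trans sv vT)) _.
  by rewrite ler_wpM2l//; lra.
have fin (F : R -> R) : M.-lipschitz F ->
   (forall s, u < s -> s < v -> has_derivative_within (timeline t0) X s (F (X s))) ->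
   `|X v - X u - F (X u) * (v - u)| <= eta * (v - u).
  move=> lF dX.
  have [c|c|] := @MVT_segment R X (F \o X) u v uv.
  - rewrite in_itv/= => /andP[uc cv].
    apply: (has_derivative_within_is_derive t0); first exact: le_lt_trans uc.
    exact: dX.
  - apply: (@continuous_subspaceW _ _ _ `[t0, v]).
      by move=> s /=; rewrite !in_itv/= => /andP[us ->]; rewrite (le_trans t0u).
    exact: lip_on_continuous (lX v).
  - move=> c; rewrite in_itv/= => /andP[uc cv] ->; rewrite -mulrBl normrM.
    rewrite (ger0_norm (eqbRL (subr_ge0 _ _) uv)) ler_wpM2r ?subr_ge0//.
    have := lF (X c, X u) (conj I I) => /= /le_trans; apply; apply: le_trans r2.
    by rewrite ler_wpM2l//; case: (near c uc cv).
split => Hu; apply: fin => // s us sv;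
  have [h1 h2] := near s (ltW us) (ltW sv);
  have [HF1 HF2] := solX s (le_trans t0u (ltW us)).
- by apply: HF1; move: h1 (le_trans h2 r1) Hu; rewrite !ler_norml; lra.
- by apply: HF2; move: h1 (le_trans h2 r1) Hu; rewrite !ler_norml; lra.
Qed.

Lemma increments_has_derivative_within {R : realType} (F Y : R -> R)
    (M L t0 t : R) : M.-lipschitz F -> 0 <= M -> 0 <= L ->
  (forall u v, u <= v -> `|Y v - Y u| <= L * (v - u)) -> t0 <= t ->
  (forall e, 0 < e -> exists2 r, 0 < r & forall u v, t0 <= u -> u <= v ->
     v - u <= r -> `|u - t| <= r ->
     `|Y v - Y u - F (Y u) * (v - u)| <= e * (v - u)) ->
  has_derivative_within (timeline t0) Y t (F (Y t)).
Proof.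
move=> lF M0 L0 lY t0t H; apply/cvgrPdist_le => e e0.
have [r r0 Hr] := H (e / 2) ltac:(rewrite divr_gt0//).
rewrite !near_withinE.
apply/nbhs_ballP; exists (Num.min r (e / 2 / (M * L + 1))) => /=.
  by rewrite lt_min r0 !divr_gt0// ltr_wpDl// mulr_ge0.
move=> s; rewrite /ball/= lt_min => /andP[tsr ts2] st.
rewrite /timeline/= in_itv/= andbT => t0s.
have ML : 0 <= M * L by rewrite mulr_ge0.
have {}ts2 : M * (L * `|t - s|) <= e / 2.
  rewrite mulrA; apply: (@le_trans _ _ ((M * L + 1) * `|t - s|)).
    by rewrite ler_wpM2r// lerDl.
  by rewrite mulrC -ler_pdivlMr ?ltr_wpDl// ltW.
have st0 : 0 < `|s - t| by rewrite normr_gt0 subr_eq0.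
suff : `|Y s - Y t - F (Y t) * (s - t)| <= e * `|s - t|.
  have -> : Y s - Y t - F (Y t) * (s - t) = - ((F (Y t) - (Y s - Y t) / (s - t)) * (s - t)).
    have : s - t != 0 by rewrite subr_eq0.
    by move=> ?; field.
  by rewrite normrN normrM ler_pM2r.
move: tsr ts2; have [ts|/ltW ts] := lerP t s => tsr ts2.
  apply: le_trans (Hr t s t0t ts (ltW tsr) _) _.
    by rewrite subrr normr0 ltW.
  by rewrite ler_wpM2r ?subr_ge0//; lra.
(* For a left difference quotient the increment starts at [s], with slope [F (Y s)]; replacing it by
   [F (Y t)] costs the other half of [e]. *)
have h := Hr s t t0s ts (ltW tsr).
have {}h := h ltac:(rewrite distrC ger0_norm ?subr_ge0// ltW//).
have FF : `|F (Y t) - F (Y s)| <= e / 2.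
  have := lF (Y t, Y s) (conj I I) => /= /le_trans; apply; apply: le_trans ts2.
  by rewrite ler_wpM2l// lY.
have -> : Y s - Y t - F (Y t) * (s - t) =
  - (Y t - Y s - F (Y s) * (t - s)) + (F (Y t) - F (Y s)) * (t - s) by ring.
apply: le_trans (ler_normD _ _) _; rewrite normrN normrM.
rewrite [`|t - s|]ger0_norm ?subr_ge0//.
have : `|F (Y t) - F (Y s)| * (t - s) <= e / 2 * (t - s).
  by rewrite ler_wpM2r// subr_ge0.
by lra.
Qed.

(** Where [b t != Y t], the gap keeps at least half its size near [t]. Once [eta] is below this
    half, all increments near [t] are governed by the same [F], which yields the derivative. *)
Lemma approx_lipschitz_solution {R : realType} (F1 F2 b Y : R -> R)
    (M t0 x0 : R) : 0 <= M -> M.-lipschitz F1 -> M.-lipschitz F2 ->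
  (forall T, {within `[t0, T], continuous b}) ->
  (forall u v, u <= v -> `|Y v - Y u| <= M * (v - u)) -> Y t0 = x0 ->
  (forall T eta, 0 < eta -> exists2 rho, 0 < rho &
     approx_solution F1 F2 t0 T eta rho (fun t => b t - Y t) Y) ->
  lipschitz_solution F1 F2 t0 x0 b Y.
Proof.
move=> M0 lF1 lF2 cb lY Yt0 H; split => //.
  rewrite /lipschitz_on; near=> L => -[u v] /= _.
  have ML : M <= L by near: L; apply: nbhs_pinfty_ge; rewrite num_real.
  have [uv|/ltW vu] := lerP u v.
    by rewrite distrC (le_trans (lY _ _ uv))// ler_wpM2r// subr_ge0.
  by rewrite (le_trans (lY _ _ vu))// ler_wpM2r// subr_ge0.
move=> t t0t.
have near gap : 0 < gap -> exists2 r, 0 < r & forall u, t0 <= u -> `|u - t| <= r ->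
    u <= t + 1 /\ `|(b u - Y u) - (b t - Y t)| <= gap.
  move=> g0; have [d d0 Hd] := segment_uniform_continuity t0 (t + 1) b (cb _)
    (gap / 2) ltac:(rewrite divr_gt0//).
  exists (Num.min (Num.min 1 d) (gap / 2 / (M + 1))).
    by rewrite !lt_min ltr01 d0 !divr_gt0// ltr_wpDl.
  move=> u t0u; rewrite !le_min => /andP[/andP[ut1 utd] utg].
  have ut : u <= t + 1 by move: ut1; rewrite ler_norml; lra.
  split => //.
  have h1 : `|b u - b t| <= gap / 2 by apply: Hd => //; apply/andP; split=> //; lra.
  have h2 : `|Y u - Y t| <= gap / 2.
    rewrite ler_pdivlMr ?ltr_wpDl// in utg; apply: le_trans utg.
    rewrite mulrC.
    apply: (@le_trans _ _ (M * `|u - t|)); last by rewrite ler_wpM2r// lerDl.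
    have [ut'|/ltW tu'] := lerP u t; last exact: lY.
    by rewrite distrC; exact: lY.
  have -> : b u - Y u - (b t - Y t) = (b u - b t) - (Y u - Y t) by ring.
  by apply: le_trans (ler_normB _ _) _; lra.
have fin (F : R -> R) : M.-lipschitz F -> b t - Y t != 0 ->
   (forall eta rho, 0 < eta ->
     approx_solution F1 F2 t0 (t + 2) eta rho (fun t => b t - Y t) Y ->
     forall u v, t0 <= u -> u <= v -> v <= t + 2 -> v - u <= rho ->
       `|(b u - Y u) - (b t - Y t)| <= `|b t - Y t| / 2 -> eta <= `|b t - Y t| / 2 ->
       `|Y v - Y u - F (Y u) * (v - u)| <= eta * (v - u)) ->
   has_derivative_within (timeline t0) Y t (F (Y t)).
  move=> lF nz G; apply: (increments_has_derivative_within F Y M M) => // e e0.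
  have g0 : 0 < `|b t - Y t| / 2 by rewrite divr_gt0// normr_gt0.
  pose eta := Num.min e (`|b t - Y t| / 2).
  have eta0 : 0 < eta by rewrite lt_min e0.
  have [rho rho0 A] := H (t + 2) eta eta0.
  have [r r0 Hr] := near _ g0.
  exists (Num.min (Num.min r rho) 1); first by rewrite !lt_min r0 rho0 ltr01.
  move=> u v t0u uv; rewrite !le_min => /andP[/andP[vur vurho] vu1] /andP[/andP[utr utrho] ut1].
  have [ut1' gap] := Hr u t0u utr.
  apply: (@le_trans _ _ (eta * (v - u))).
    by apply: (G eta rho) => //; rewrite /eta ?ge_min ?lexx ?orbT//; lra.
  by rewrite ler_wpM2r ?subr_ge0// /eta ge_min lexx.
split => bY; apply: fin => //.
- by rewrite subr_eq0 lt_eqF.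
- move=> eta rho eta0 A u v t0u uv vt vu; have [A1 _] := A u v t0u uv vt vu.
  rewrite [`|b t - Y t|]ltr0_norm ?subr_lt0// => g1 g2; apply: A1.
  by move: g1 g2; rewrite ler_norml; lra.
- by rewrite subr_eq0 gt_eqF.
- move=> eta rho eta0 A u v t0u uv vt vu; have [_ A2] := A u v t0u uv vt vu.
  rewrite [`|b t - Y t|]gtr0_norm ?subr_gt0// => g1 g2; apply: A2.
  by move: g1 g2; rewrite ler_norml; lra.
Unshelve. all: by end_near.
Qed.

(** The tolerance doubles because [psi (E n u)] is only known to be within [eta] of [psi (Y u)]: a
    margin [2 * eta] for [Y] is a margin [eta] for [E n]. *)
Lemma approx_solution_lim {R : realType} (F1 F2 psi w Y : R -> R)
    (E : nat -> R -> R) (M t0 T eta rho : R) (n0 : nat) :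
  0 <= M -> M.-lipschitz F1 -> M.-lipschitz F2 -> 0 < eta ->
  (forall x y, `|psi x - psi y| <= `|x - y|) ->
  (forall n, (n0 <= n)%N ->
    approx_solution F1 F2 t0 T eta rho (fun t => w t - psi (E n t)) (E n)) ->
  (forall t, t0 <= t -> t <= T -> E ^~ t @ \oo --> Y t) ->
  approx_solution F1 F2 t0 T (2 * eta) rho (fun t => w t - psi (Y t)) Y.
Proof.
move=> M0 lF1 lF2 eta0 lpsi A EY u v t0u uv vT vu.
have [<-|u_v] := eqVneq u v.
  by rewrite !subrr !mulr0 subr0 normr0.
have uv0 : 0 < v - u by rewrite subr_gt0 lt_neqAle u_v.
(* Replacing [E n] by [Y] costs [e] at [u], [e] at [v] and [M * e * (v - u)] in the slope. This must
   fit in [eta * (v - u)], whence the separate case [u = v]. *)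
have [e [e0 e1 e2]] : exists e, [/\ 0 < e, e <= eta & e * (2 + M * (v - u)) <= eta * (v - u)].
  have p : 0 < 2 + M * (v - u) by rewrite ltr_pwDl// mulr_ge0// ltW.
  exists (Num.min eta (eta * (v - u) / (2 + M * (v - u)))); split.
  - by rewrite lt_min eta0 divr_gt0// mulr_gt0.
  - by rewrite ge_min lexx.
  - by rewrite -ler_pdivlMr// ge_min lexx orbT.
have uT := le_trans uv vT; have t0v := le_trans t0u uv.
have /cvgrPdist_le/(_ e e0)[n1 _ H1] := EY u t0u uT.
have /cvgrPdist_le/(_ e e0)[n2 _ H2] := EY v t0v vT.
pose n := maxn n0 (maxn n1 n2).
have {}H1 := H1 n ltac:(rewrite /= !leq_max leqnn orbT//).
have {}H2 := H2 n ltac:(rewrite /= !leq_max leqnn !orbT//).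
have [A1 A2] := A n (leq_maxl _ _) u v t0u uv vT vu.
have hpsi : `|psi (Y u) - psi (E n u)| <= eta.
  by apply: le_trans (lpsi _ _) _; exact: le_trans H1 e1.
have fin (F : R -> R) : M.-lipschitz F ->
  `|E n v - E n u - F (E n u) * (v - u)| <= eta * (v - u) ->
  `|Y v - Y u - F (Y u) * (v - u)| <= 2 * eta * (v - u).
  move=> lF h.
  have h3 : `|(F (Y u) - F (E n u)) * (v - u)| <= M * e * (v - u).
    rewrite normrM (gtr0_norm uv0) ler_pM2r//.
    have := lF (Y u, E n u) (conj I I) => /= /le_trans; apply.
    by rewrite ler_wpM2l.
  have -> : Y v - Y u - F (Y u) * (v - u) =
     (E n v - E n u - F (E n u) * (v - u)) + (Y v - E n v) - (Y u - E n u)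
      - (F (Y u) - F (E n u)) * (v - u) by ring.
  apply: le_trans (ler_normB _ _) _.
  apply: le_trans (lerD (ler_normB _ _) (lexx _)) _.
  apply: le_trans (lerD (lerD (ler_normD _ _) (lexx _)) (lexx _)) _.
  move: H1 H2 h h3 e2; lra.
split => Hu; apply: fin => //.
- by apply: A1; move: hpsi Hu; rewrite ler_norml; lra.
- by apply: A2; move: hpsi Hu; rewrite ler_norml; lra.
Qed.

(** * Number of visits to a small interval *)

(** Only the last [c] hits can be followed by fewer than [c] hits. *)
Lemma count_before_last (a : pred nat) (c l n : nat) :
  (count a (iota l n) - c <=
   count (fun i => a i && (c <= count a (iota i.+1 (l + n - i.+1))))
     (iota l n))%N.
Proof.
elim: n l => [|n IH] l //=.
have -> : (l + n.+1 - l.+1 = n)%N by lia.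
have := IH l.+1; rewrite addSnnS.
set A := count _ (iota l.+1 n); set B := count _ (iota l.+1 n) => AB.
case: (a l) => //=; rewrite ?add0n//.
by case: leqP; lia.
Qed.

Section many_hits.
Context {R : realType} {d} {T : measurableType d} (P : probability T R).

Definition pr (U : set T) : R := fine (P U).

Lemma prE U : measurable U -> P U = (pr U)%:E.
Proof. by move=> mU; rewrite fineK// fin_num_measure. Qed.

Lemma pr_ge0 U : 0 <= pr U.
Proof. by rewrite fine_ge0. Qed.

Lemma le_pr U V : measurable U -> measurable V -> U `<=` V -> pr U <= pr V.
Proof.
by move=> mU mV UV; rewrite -lee_fin -!prE//; apply: le_measure; rewrite ?inE.
Qed.

Lemma pr_split U V : measurable U -> measurable V ->
  pr U = pr (U `\` V) + pr (U `&` V).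
Proof.
move=> mU mV; apply/EFin_inj; rewrite EFinD -!prE//.
- by rewrite (measureDI P mU mV).
- exact: measurableI.
- exact: measurableD.
Qed.

Lemma measurable_count (I : nat -> set T) (c : nat) (s : seq nat) :
  (forall i, i \in s -> measurable (I i)) ->
  measurable [set w | (c <= count (fun i => `[< I i w >]) s)%N].
Proof.
elim: s c => [|i s IH] [|c] /= mI.
- by rewrite (_ : [set _ | _] = setT)//; apply/seteqP; split.
- by rewrite (_ : [set _ | _] = set0)//; apply/seteqP; split.
- by rewrite (_ : [set _ | _] = setT)//; apply/seteqP; split.
rewrite (_ : [set _ | _] =
  (I i `&` [set w | (c <= count (fun i => `[< I i w >]) s)%N]) `|`
  (~` I i `&` [set w | (c.+1 <= count (fun i => `[< I i w >]) s)%N])).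
  have mIi : measurable (I i) by apply: mI; exact: mem_head.
  have {}mI j : j \in s -> measurable (I j).
    by move=> js; apply: mI; rewrite in_cons js orbT.
  by apply: measurableU; apply: measurableI; [|exact: IH|exact: measurableC|exact: IH].
apply/seteqP; split => w /=.
  by have [Iw|Iw] := pselect (I i w); rewrite ?(asboolT Iw) ?(asboolF Iw)/= => h; [left|right].
by move=> [] [Iw h]; rewrite ?(asboolT Iw) ?(asboolF Iw).
Qed.

(** Markov's inequality for a sum of indicators, by induction on [s]: after splitting [E] along
    [I i], the part inside [I i] needs one hit less from the rest of the list. *)
Lemma count_markov (I : nat -> set T) (s : seq nat) (E : set T) (n : nat) :
  (forall i, measurable (I i)) -> measurable E ->
  (forall w, E w -> (n <= count (fun i => `[< I i w >]) s)%N) ->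
  n%:R * pr E <= \sum_(i <- s) pr (E `&` I i).
Proof.
move=> mI; elim: s E n => [|i s IH] E n mE H.
  rewrite big_nil; have [->|/set0P[w /H]] := eqVneq E set0.
    by rewrite /pr measure0 mulr0.
  by rewrite leqn0 => /eqP ->; rewrite mul0r.
rewrite big_cons (pr_split E (I i))// mulrDr.
have mD := measurableD mE (mI i); have mEI := measurableI _ _ mE (mI i).
have H1 := IH (E `\` I i) n mD.
have H2 := IH (E `&` I i) n.-1 mEI.
have {}H1 : n%:R * pr (E `\` I i) <= \sum_(j <- s) pr ((E `\` I i) `&` I j).
  by apply: H1 => w [Ew Iw]; have := H w Ew; rewrite /= asboolF.
have {}H2 : n.-1%:R * pr (E `&` I i) <= \sum_(j <- s) pr ((E `&` I i) `&` I j).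
  by apply: H2 => w [Ew Iw]; have := H w Ew; rewrite /= asboolT//; case: (n).
have -> : \sum_(j <- s) pr (E `&` I j) =
   \sum_(j <- s) pr ((E `\` I i) `&` I j) + \sum_(j <- s) pr ((E `&` I i) `&` I j).
  rewrite -big_split/=; apply: eq_bigr => j _.
  rewrite (pr_split (E `&` I j) (I i))//; last exact: measurableI.
  by rewrite setIDAC setIDA [(E `&` I j) `&` I i]setIAC.
have : n%:R * pr (E `&` I i) <= n.-1%:R * pr (E `&` I i) + pr (E `&` I i).
  rewrite -[X in _ <= _ + X]mul1r -mulrDl ler_wpM2r ?pr_ge0// natr1 ler_nat.
  by case: (n).
by lra.
Qed.

(* Induction on p: if there are p + 1 times n hits, then at least n of the hits
   are followed by p * n hits, and Markov's inequality applies to these. *)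
Lemma many_hits_le (G : nat -> set (set T)) (I : nat -> set T) (q : nat -> R)
    (m J n p l : nat) (U : set T) :
  (forall i U, G i U -> measurable U) ->
  (forall i, G i (I i)) ->
  (forall i j, (i <= j)%N -> G i `<=` G j) ->
  (forall i U V, G i U -> G i V -> G i (U `&` V)) ->
  (forall i, 0 <= q i) ->
  (forall i j U, (i < j)%N -> G i U -> pr (U `&` I j) <= q (j - i)%N * pr U) ->
  G l U -> (l <= m)%N -> (m - l <= J)%N ->
  n%:R ^+ p * pr (U `&` [set w | (p * n <= count (fun i => `[< I i w >]) (iota l.+1 (m - l)))%N])
    <= (\sum_(1 <= i < J.+1) q i) ^+ p * pr U.
Proof.
move=> mG GI Gmono GcapI q0 step; move: l U.
have mI i : measurable (I i) by exact: mG (GI i).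
elim: p => [|p IH] l U GU lm lJ.
  rewrite !expr0 !mul1r; apply: le_pr; last by move=> w [].
    by apply: measurableI; [exact: mG GU|exact: measurable_count].
  exact: mG GU.
set Q := \sum_(_ <= _ < _) _.
have Q0 : 0 <= Q by rewrite sumr_ge0.
set E := U `&` _.
have mU := mG _ _ GU.
have mE : measurable E by apply: measurableI => //; exact: measurable_count.
pose late i : set T := I i `&` [set w | (p * n <= count (fun i => `[< I i w >]) (iota i.+1 (m - i)))%N].
have mlate i : measurable (late i).
  by apply: measurableI => //; exact: measurable_count.
have := count_markov late (iota l.+1 (m - l)) E n mlate mE.
have Elate w : E w -> (n <= count (fun i => `[< late i w >]) (iota l.+1 (m - l)))%N.
  move=> [_ /= h].
  have := count_before_last (fun i => `[< I i w >]) (p * n) l.+1 (m - l).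
  rewrite [X in (_ <= X)%N -> _](@eq_count _ _ (fun i => `[< late i w >])); last first.
    move=> i /=; rewrite addSn subSS subnKC//.
    by rewrite /late asbool_and /=; congr (_ && _); rewrite asboolb.
  by apply: leq_trans; move: h; rewrite mulSn; move: (count _ _) (p * n)%N => a b; lia.
move=> /(_ Elate) h.
(* The differences [i - l] are distinct and lie between 1 and [J], so the factors [q (i - l)] add up
   to at most [Q]. *)
have h2 : Q ^+ p * (\sum_(i <- iota l.+1 (m - l)) pr (U `&` I i)) <= Q ^+ p * (Q * pr U).
  rewrite ler_wpM2l ?exprn_ge0//.
  apply: (@le_trans _ _ (\sum_(i <- iota l.+1 (m - l)) q (i - l)%N * pr U)).
    rewrite big_seq [leRHS]big_seq; apply: ler_sum => i.
    by rewrite mem_iota => /andP[li _]; exact: step.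
  rewrite -mulr_suml ler_wpM2r ?pr_ge0//.
  rewrite -(addn1 l) iotaDl big_map.
  rewrite (eq_bigr q) => [|i _]; last by rewrite addKn.
  rewrite /Q /index_iota subSS subn0 -(subnKC lJ) iotaD big_cat/=.
  by rewrite lerDl sumr_ge0.
apply: le_trans (_ : _ <= Q ^+ p * (\sum_(i <- iota l.+1 (m - l)) pr (U `&` I i))) _; last first.
  by apply: le_trans h2 _; rewrite exprSr mulrA.
rewrite exprSr -mulrA.
apply: (@le_trans _ _ (n%:R ^+ p * \sum_(i <- iota l.+1 (m - l)) pr (E `&` late i))).
  by rewrite ler_wpM2l// exprn_ge0.
rewrite !mulr_sumr big_seq [leRHS]big_seq; apply: ler_sum => i.
rewrite mem_iota => /andP[li im].
(* A hit at [i] is an event of [G i], so the induction restarts from [i] with the hit added to the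
   past event. *)
have GUi : G i (U `&` I i).
  by apply: GcapI; [exact: Gmono (ltnW li) _ GU|exact: GI].
apply: le_trans (IH i (U `&` I i) GUi _ _).
- rewrite ler_wpM2l ?exprn_ge0//; apply: le_pr.
  + exact: measurableI.
  + by apply: measurableI; [exact: mG GUi|exact: measurable_count].
  + by move=> w [[Uw _] [Iw h']].
- by move: im; rewrite addSn subnKC.
- by apply: leq_trans lJ; rewrite leq_sub2l// ltnW.
Qed.

End many_hits.

(** A comparison with the integral of [x^(-gamma)]. With [a = 1 - gamma] and [y = n / (n + 1)], the
    induction step amounts to [y^a <= 1 - a / (n + 1)]. *)
Lemma sum_powRN_le {R : realType} (gamma : R) (n : nat) : 0 < gamma < 1 ->
  \sum_(1 <= i < n.+1) i%:R `^ (- gamma) <= n%:R `^ (1 - gamma) / (1 - gamma).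
Proof.
move=> /andP[g0 g1]; have a0 : 0 < 1 - gamma by rewrite subr_gt0.
elim: n => [|n IH].
  by rewrite big_geq// divr_ge0 ?powR_ge0// ltW.
rewrite big_nat_recr//=; apply: le_trans (lerD IH (lexx _)) _.
rewrite ler_pdivlMr// mulrDl divfK ?gt_eqF//.
set a := 1 - gamma.
have n0 : 0 < n.+1%:R :> R by rewrite ltr0n.
set y : R := n%:R / n.+1%:R.
have y0 : 0 <= y by rewrite divr_ge0.
(* Young's inequality gives the tangent line bound for the concave y^a *)
have young : y `^ a <= a * y + (1 - a).
  have b0 : 0 < 1 - a by rewrite /a; lra.
  have := @conjugate_powR R (y `^ a) 1 a^-1 (1 - a)^-1 (powR_ge0 _ _) ler01.
  rewrite !invr_gt0 !invrK => /(_ a0 b0).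
  rewrite mulr1 powR1 mul1r -powRrM divff ?gt_eqF// powRr1// => h.
  by rewrite (le_trans (h _))//; [lra|rewrite mulrC].
have nE : n%:R = n.+1%:R * y :> R by rewrite /y mulrC divfK// gt_eqF.
have -> : n%:R `^ a = n.+1%:R `^ a * y `^ a :> R by rewrite nE powRM// ltW.
have ng : n.+1%:R `^ (- gamma) = n.+1%:R `^ a * n.+1%:R^-1 :> R.
  rewrite -(@powR_inv1 _ n.+1%:R) ?ltW// -powRD; last first.
    by rewrite (gt_eqF n0) implybT.
  by congr (_ `^ _); rewrite /a; ring.
rewrite ng -mulrA -mulrDr ger_pMr ?powR_gt0//.
have : a * y = a - n.+1%:R^-1 * a.
  have nz : n%:R + 1 != 0 :> R by rewrite natr1 gt_eqF.
  by rewrite /y -natr1; field.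
move=> ayE; move: young; rewrite ayE.
by move: (y `^ a) (n.+1%:R^-1) => u v; clearbody a; lra.
Qed.

(** * Measurability of sparseness *)

Lemma measurable_forall {d} {T : measurableType d}
    (p : nat -> Prop) (Q : nat -> T -> Prop) :
  (forall i, p i -> measurable [set w | Q i w]) ->
  measurable [set w | forall i, p i -> Q i w].
Proof. exact: (@bigcap_measurableType _ _ (fun i => [set w | Q i w]) p). Qed.

Lemma measurable_exists2 {d} {T : measurableType d}
    (p : nat -> Prop) (Q : nat -> T -> Prop) :
  (forall i, p i -> measurable [set w | Q i w]) ->
  measurable [set w | exists2 i, p i & Q i w].
Proof. exact: (@bigcup_measurable _ _ (fun i => [set w | Q i w]) p). Qed.

Section measurable_sparse.
Context {R : realType} {d} {T : measurableType d} (t0 : R) (N : nat)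
  (beta : T -> R -> R).
Hypothesis mbeta : forall t, t0 <= t <= t0 + N%:R ->
  measurable_fun setT (beta ^~ t).

Lemma measurable_hit (eps : R) (m i : nat) :
  t0 <= tick t0 m i <= t0 + N%:R ->
  measurable [set w | `|beta w (tick t0 m i)| < eps].
Proof.
move=> it; have mt := mbeta _ it.
rewrite (_ : [set w | _] = setT `&` (fun w => beta w (tick t0 m i)) @^-1` `]- eps, eps[).
  exact: mt.
by rewrite setTI; apply/seteqP; split => w /=; rewrite in_itv/= ltr_norml.
Qed.

Lemma tick_le_horizon (k n j i : nat) : (j.+2 <= N * k.+1)%N ->
  i \in iota (j * n.+1).+1 (2 * n.+1) ->
  t0 <= tick t0 (k.+1 * n.+1) i <= t0 + N%:R.
Proof.
move=> jN; rewrite mem_iota => /andP[_ ij]; rewrite tick_ge/= /tick lerD2l.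
rewrite ler_pdivrMr ?ltr0n// -natrM ler_nat.
by move: ij; rewrite addSn ltnS -mulnDl addn2 => /leq_trans; apply; rewrite mulnA leq_mul.
Qed.

Lemma hitsE (eps : R) (m a l : nat) (w : T) :
  hits t0 (beta w) eps m a l =
  count (fun i => `[< [set w | `|beta w (tick t0 m i)| < eps] w >]) (iota a l).
Proof. by apply: eq_count => i /=; rewrite asboolb. Qed.

Lemma measurable_hits_gt (eps th : R) (k n j : nat) : 0 <= th ->
  (j.+2 <= N * k.+1)%N ->
  measurable [set w | th < (hits t0 (beta w) eps (k.+1 * n.+1) (j * n.+1).+1 (2 * n.+1))%:R].
Proof.
move=> th0 jN; under eq_set => w do rewrite -truncn_lt_nat// hitsE.
apply: measurable_count => i /(tick_le_horizon _ _ _ _ jN).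
exact: measurable_hit.
Qed.

Lemma measurable_few_hits (th : R) (k n : nat) : 0 <= th ->
  measurable [set w | few_hits t0 N th k n (beta w)].
Proof.
move=> th0; apply: measurable_forall => j jN.
under eq_set => w do rewrite leNgt.
rewrite (_ : [set w | _] = ~` [set w | th * 2^-1 ^+ k * (k.+1 * n.+1)%:R <
   (hits t0 (beta w) (2 * 2^-1 ^+ k) (k.+1 * n.+1) (j * n.+1).+1 (2 * n.+1))%:R]).
  apply: measurableC; apply: measurable_hits_gt => //.
  by rewrite !mulr_ge0// exprn_ge0// invr_ge0.
by apply/seteqP; split => w /= /negP.
Qed.

(** Counting on grids instead of measuring occupation times leaves only quantifiers over [nat] and
    evaluations at countably many times. *)
Lemma measurable_sparse : measurable [set w | sparse t0 N (beta w)].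
Proof.
rewrite (_ : [set w | _] = [set w | forall q : nat, True -> exists2 k0 : nat, True &
   forall k : nat, (k0 <= k)%N -> forall m : nat, True ->
     exists2 n : nat, (m <= n)%N & few_hits t0 N q.+1%:R^-1 k n (beta w)]).
  apply: measurable_forall => q _; apply: measurable_exists2 => k0 _.
  apply: measurable_forall => k k0k; apply: measurable_forall => m _.
  apply: measurable_exists2 => n mn; apply: measurable_few_hits.
  by rewrite invr_ge0.
apply/seteqP; split => w H q.
  by move=> _; have [k0 Hk0] := H q; exists k0 => // k kk m _; exact: Hk0.
by have [k0 _ Hk0] := H q I; exists k0 => k kk m; exact: Hk0.
Qed.

End measurable_sparse.

(** * Almost sure sparseness under the conditional density bound *)

Section almost_surely_sparse.
Context {R : realType} {d} {T : measurableType d} (P : probability T R).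
Context (t0 c1 gamma lvl : R) (x : R -> T -> R).
Hypothesis mx : forall t, t0 <= t -> measurable_fun setT (x t).
Hypothesis c10 : 0 < c1.
Hypothesis gamma01 : 0 < gamma < 1.
Hypothesis density : conditional_density_bound P t0 x c1 gamma.

Local Notation Fil s := (<<s generators `[t0, s] x >>).

Lemma filtration_measurable s U : Fil s U -> measurable U.
Proof.
apply: smallest_sub; first exact: sigma_algebra_measurable.
move=> V [t /=]; rewrite in_itv/= => /andP[t0t _] [A mA <-].
exact: mx.
Qed.

Lemma filtration_le s t : s <= t -> Fil s `<=` Fil t.
Proof.
move=> st; apply: sub_sigma_algebra2 => V [u /=].
rewrite in_itv/= => /andP[t0u us] HV; exists u => //=.
by rewrite in_itv/= t0u (le_trans us).
Qed.

Lemma filtrationI s U V : Fil s U -> Fil s V -> Fil s (U `&` V).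
Proof. exact: (@measurableI _ (history t0 x s)). Qed.

Lemma filtration_preimage t A : t0 <= t -> measurable A -> Fil t (x t @^-1` A).
Proof.
move=> t0t mA; apply: sub_sigma_algebra; exists t => /=.
  by rewrite in_itv/= t0t lexx.
by exists A => //; rewrite setTI.
Qed.

Lemma density_event s t U A : t0 <= s -> s < t -> Fil s U -> measurable A ->
  (P (U `&` x t @^-1` A) <= (c1 / (t - s) `^ gamma)%:E * lebesgue_measure A * P U)%E.
Proof.
move=> t0s st FU mA; have [k [kP kle]] := density s t t0s st.
have := kP U A FU mA; rewrite /= => ->.
have mU := filtration_measurable _ _ FU.
set c := ((c1 / (t - s) `^ gamma)%:E * lebesgue_measure A)%E.
have c0 : (0 <= c)%E.
  by rewrite mule_ge0// lee_fin divr_ge0 ?powR_ge0// ltW.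
rewrite -(integral_cst P mU c).
apply: ae_ge0_le_integral => //.
- move=> _ Y mY; apply: measurableI => //; rewrite -[X in measurable X]setTI.
  apply: (filtration_measurable s).
  exact: (measurable_kernel k A mA measurableT Y mY).
- by apply: (@filterS _ _ (ae_filter_ringOfSetsType P) _ _ _ kle) => w H _; exact: H.
Qed.

Local Notation beta w := (fun t => x t w - lvl).

Lemma mbeta t : t0 <= t -> measurable_fun setT (fun w => beta w t).
Proof. by move=> t0t; apply: measurable_funB => //; exact: mx. Qed.

Lemma hit_preimage (t eps : R) :
  [set w | `|beta w t| < eps] = x t @^-1` `](lvl - eps), (lvl + eps)[.
Proof. by apply/seteqP; split => w /=; rewrite in_itv/= ltr_norml; lra. Qed.

(** The interval visited has length [2 * eps]; as the ticks are equally spaced, the factor depends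
    on [j - i] only, the form that [many_hits_le] takes. *)
Lemma hit_step (m i j : nat) (eps : R) U : (0 < m)%N -> 0 < eps -> (i < j)%N ->
  Fil (tick t0 m i) U ->
  pr P (U `&` [set w | `|beta w (tick t0 m j)| < eps]) <=
    c1 / ((j - i)%N%:R / m%:R) `^ gamma * (2 * eps) * pr P U.
Proof.
move=> m0 eps0 ij FU.
have tij : tick t0 m j - tick t0 m i = (j - i)%N%:R / m%:R.
  by rewrite /tick (natrB _ (ltnW ij)) mulrBl opprD addrACA subrr add0r.
have ltij : tick t0 m i < tick t0 m j.
  by rewrite -subr_gt0 tij divr_gt0// ltr0n// subn_gt0.
have mU := filtration_measurable _ _ FU.
have mE : measurable (x (tick t0 m j) @^-1` `](lvl - eps), (lvl + eps)[).
  by rewrite -[X in measurable X]setTI; apply: mx => //; exact: tick_ge.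
rewrite hit_preimage -lee_fin EFinM -!prE//; last exact: measurableI.
apply: le_trans (density_event _ _ _ _ (tick_ge t0 m i) ltij FU _) _ => //.
rewrite tij lebesgue_measure_itv/= lte_fin.
rewrite (_ : lvl - eps < lvl + eps); last by lra.
rewrite -EFinB -EFinM.
by have -> : lvl + eps - (lvl - eps) = 2 * eps by ring.
Qed.

(** The factor [((k + 1) * (n + 1))^gamma] comes from the mesh and [(2 * (n + 1))^(1 - gamma)] from
    [sum_powRN_le]: the powers of [n + 1] recombine, so that the bound is linear in [n + 1]. *)
Lemma window_sum_le (k n : nat) (e : R) : 0 <= e ->
  \sum_(1 <= i < (2 * n.+1).+1)
     c1 / (i%:R / (k.+1 * n.+1)%:R) `^ gamma * (2 * (2 * e)) <=
  8 * c1 / (1 - gamma) * e * k.+1%:R `^ gamma * n.+1%:R.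
Proof.
move=> e0; have /andP[g0 g1] := gamma01.
have a0 : 0 < 1 - gamma by rewrite subr_gt0.
set m : R := (k.+1 * n.+1)%:R.
have m0 : 0 < m by rewrite ltr0n.
have mg : 0 < m `^ gamma by rewrite powR_gt0.
rewrite (eq_big_nat _ _ (F2 := fun i => (4 * c1 * e * m `^ gamma) * i%:R `^ (- gamma))); last first.
  move=> i /andP[i1 _]; have i0 : 0 < i%:R :> R by rewrite ltr0n.
  have ig : 0 < i%:R `^ gamma by rewrite powR_gt0.
  have -> : (i%:R / m) `^ gamma = i%:R `^ gamma / m `^ gamma.
    apply: (canRL (mulfK _)); first by rewrite gt_eqF.
    by rewrite -powRM ?divr_ge0 ?ltW// divfK// gt_eqF.
  rewrite powRN; move: (i%:R `^ gamma) (m `^ gamma) ig mg => u v u0 v0.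
  by field; rewrite !gt_eqF.
rewrite -mulr_sumr.
have C1 : 0 <= 4 * c1 * e by rewrite mulr_ge0// mulr_ge0// ltW.
have C0 : 0 <= 4 * c1 * e * m `^ gamma by rewrite mulr_ge0 ?powR_ge0.
apply: le_trans (ler_wpM2l C0 (sum_powRN_le gamma (2 * n.+1) gamma01)) _.
have h : m `^ gamma * (2 * n.+1)%:R `^ (1 - gamma) <= 2 * (k.+1%:R `^ gamma * n.+1%:R).
  have -> : n.+1%:R = n.+1%:R `^ gamma * n.+1%:R `^ (1 - gamma) :> R.
    rewrite -powRD; last by rewrite (_ : n.+1%:R != 0)// implybT.
    by rewrite addrC subrK powRr1.
  rewrite /m !natrM !powRM//.
  rewrite -!mulrA [X in _ <= X]mulrCA ler_wpM2l ?powR_ge0//.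
  rewrite [X in _ <= X]mulrCA ler_wpM2l ?powR_ge0//.
  rewrite ler_wpM2r ?powR_ge0//.
  apply: le_trans (_ : 2 `^ 1 <= _); last by rewrite powRr1.
  by apply: ler_powR; [rewrite ler1n|lra].
have C2 : 0 <= 4 * c1 * e / (1 - gamma) by rewrite divr_ge0// ltW.
have := ler_wpM2l C2 h.
by move: (m `^ gamma) (_ `^ (1 - gamma)) (k.+1%:R `^ gamma) (n.+1%:R) (1 - gamma)^-1 => *; lra.
Qed.

Lemma window_hits_le (p k n j nu : nat) :
  nu%:R ^+ p * pr P [set w | (p * nu <= hits t0 (beta w) (2 * 2^-1 ^+ k)
     (k.+1 * n.+1) (j * n.+1).+1 (2 * n.+1))%N] <=
  (8 * c1 / (1 - gamma) * 2^-1 ^+ k * k.+1%:R `^ gamma * n.+1%:R) ^+ p.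
Proof.
have e0 : 0 < 2^-1 ^+ k :> R by rewrite exprn_gt0// invr_gt0.
set m := (k.+1 * n.+1)%N; set eps := 2 * _.
have eps0 : 0 < eps by rewrite mulr_gt0.
have m0 : (0 < m)%N by [].
pose I i := [set w | `|beta w (tick t0 m i)| < eps].
pose q i := c1 / (i%:R / m%:R) `^ gamma * (2 * eps).
have := many_hits_le P (fun i => Fil (tick t0 m i)) I q
  (j * n.+1 + 2 * n.+1) (2 * n.+1) nu p (j * n.+1) setT.
have -> : (j * n.+1 + 2 * n.+1 - j * n.+1 = 2 * n.+1)%N by rewrite addKn.
rewrite setTI.
have -> : pr P setT = 1 by rewrite /pr probability_setT.
rewrite mulr1 => H.
rewrite (_ : [set w | _] = [set w | (p * nu <=
  count (fun i => `[< I i w >]) (iota (j * n.+1).+1 (2 * n.+1)))%N]); last first.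
  by apply/seteqP; split => w /=; rewrite (hitsE t0 (fun w t => x t w - lvl)).
apply: le_trans (H _ _ _ _ _ _ _ _ _) _.
- by move=> i U; exact: filtration_measurable.
- move=> i; rewrite /I hit_preimage; apply: filtration_preimage => //.
  exact: tick_ge.
- by move=> i i' ii'; apply: filtration_le; exact: tick_le.
- by move=> i; exact: filtrationI.
- by move=> i; rewrite /q mulr_ge0// ?divr_ge0 ?powR_ge0// ?ltW// mulr_gt0.
- by move=> i i' U ii' FU; exact: hit_step.
- exact: (@measurableT _ (history t0 x (tick t0 m (j * n.+1)))).
- by rewrite leq_addr.
- by [].
rewrite lerXn2r ?nnegrE//.
- by rewrite sumr_ge0// => i _; rewrite /q mulr_ge0// ?divr_ge0 ?powR_ge0// ?ltW// mulr_gt0.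
- rewrite !mulr_ge0 ?powR_ge0// ?invr_ge0 ?ltW// subr_gt0.
  by case/andP: gamma01.
- by apply: window_sum_le; exact: ltW.
Qed.

Local Notation window_hits w k n j := (hits t0 (beta w) (2 * 2^-1 ^+ k)
     (k.+1 * n.+1) (j * n.+1).+1 (2 * n.+1)).

(** The exponent is [(gamma - 1) * p <= -3]: one power of [K] will pay for the number of windows,
    and the other two leave a summable series. *)
Lemma powR_decay (K : R) (p : nat) : 1 <= K -> 3 <= (1 - gamma) * p%:R ->
  (K `^ gamma / K) ^+ p <= (K ^+ 3)^-1.
Proof.
move=> K1 p3; have K0 : 0 < K by exact: lt_le_trans K1.
have -> : K `^ gamma / K = K `^ (gamma - 1).
  by rewrite powRD ?powR_inv1 ?ltW// (gt_eqF K0) implybT.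
rewrite -powR_mulrn ?powR_ge0// -powRrM -(powR_mulrn 3 (ltW K0)) -powRN.
by apply: ler_powR => //; lra.
Qed.

(** The threshold equals [p * y], and [p * nu] hits with [nu] the integer part of [y] are estimated
    by [window_hits_le]. In the quotient the scale [2^-k] and the factor [n + 1] cancel, leaving a
    power of [K^gamma / K]. *)
Lemma window_tail (N p q : nat) : 3 <= (1 - gamma) * p%:R ->
  exists2 C, 0 <= C & forall k, exists n0, forall n, (n0 <= n)%N -> forall j,
    (j.+2 <= N * k.+1)%N ->
    pr P [set w | (q.+1%:R^-1 * 2^-1 ^+ k * (k.+1 * n.+1)%:R : R) < (window_hits w k n j)%:R]
      <= C / k.+1%:R ^+ 3.
Proof.
move=> p3; have /andP[g0 g1] := gamma01.
have a0 : 0 < 1 - gamma by rewrite subr_gt0.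
have p0 : 0 < p%:R :> R.
  rewrite ltr0n lt0n; apply/eqP => p0; move: p3; rewrite p0 mulr0; lra.
set th : R := q.+1%:R^-1; have th0 : 0 < th by rewrite invr_gt0.
pose A := 8 * c1 / (1 - gamma).
have A0 : 0 < A by rewrite divr_gt0// mulr_gt0.
exists ((2 * A * p%:R / th) ^+ p) => [|k].
  by rewrite exprn_ge0// divr_ge0 ?ltW// mulr_gt0// mulr_gt0.
set e : R := 2^-1 ^+ k; have e0 : 0 < e by rewrite exprn_gt0// invr_gt0.
set K : R := k.+1%:R; have K0 : 0 < K by rewrite ltr0n.
have K1 : 1 <= K by rewrite ler1n.
have y0 : 0 < th * e * K / p%:R by rewrite divr_gt0// mulr_gt0// mulr_gt0.
have [n0 Hn0] := eventually_invS_le _ y0.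
exists n0 => n nn0 j jN.
have n'0 : 0 < n.+1%:R :> R by rewrite ltr0n.
pose y := th * e * K / p%:R * n.+1%:R.
have y1 : 1 <= y.
  by rewrite /y -ler_pdivrMr// div1r; exact: Hn0.
have [nu /andP[nu1 nu2]] := nat_floor y (le_trans ler01 y1).
have nu0 : 1 <= nu%:R :> R.
  by rewrite ler1n lt0n; apply/eqP => nu0; move: nu2; rewrite nu0 ltNge y1.
have ynu : y / 2 <= nu%:R by move: nu2; rewrite -natr1; lra.
set S := [set w | _].
have mS : measurable S.
  apply: (@measurable_hits_gt _ _ _ t0 N (fun w t => x t w - lvl)) => //.
  - by move=> t /andP[t0t _]; exact: mbeta.
  - by rewrite mulr_ge0 ?ltW// mulr_gt0.
set S' := [set w | (p * nu <= window_hits w k n j)%N].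
have mS' : measurable S'.
  (* The offset [1 / 2] turns the weak inequality between integers into a strict one; the case
     [p * nu = 0] is apart because the threshold must be nonnegative. *)
  rewrite (_ : S' = [set w | ((p * nu)%:R - 1 / 2 : R) < (window_hits w k n j)%:R]).
    have [->|pnu] := eqVneq (p * nu)%N 0%N.
      rewrite (_ : [set w | _] = setT)//; apply/seteqP; split => // w _ /=.
      by rewrite sub0r; apply: lt_le_trans (ler0n _ _); rewrite oppr_lt0.
    apply: (@measurable_hits_gt _ _ _ t0 N (fun w t => x t w - lvl)) => //.
    - by move=> t /andP[t0t _]; exact: mbeta.
    - have : 1 <= (p * nu)%:R :> R by rewrite ler1n lt0n.
      by lra.
  apply/seteqP; split => w; rewrite /S' /=.
    by rewrite -(ler_nat R); lra.
  move=> h; rewrite leqNgt; apply/negP => h'; move: h' h.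
  by rewrite -(ler_nat R) -natr1; lra.
have SS' : S `<=` S'.
  move=> w; rewrite /S /S' /= => h; rewrite -(ler_nat R) natrM.
  apply: ltW; apply: le_lt_trans h.
  apply: (@le_trans _ _ (p%:R * y)); first by rewrite ler_pM2l.
  by rewrite /y natrM -/K mulrAC mulrCA divff ?gt_eqF// mulr1 !mulrA.
apply: le_trans (le_pr P _ _ mS mS' SS') _.
have := window_hits_le p k n j nu; rewrite -/S' -/A -/e -/K => h.
have {}h : (y / 2) ^+ p * pr P S' <= (A * e * K `^ gamma * n.+1%:R) ^+ p.
  apply: le_trans h; rewrite ler_wpM2r ?pr_ge0// lerXn2r ?nnegrE//.
  by rewrite divr_ge0// (le_trans ler01).
have yp : 0 < (y / 2) ^+ p.
  by rewrite exprn_gt0// divr_gt0// (lt_le_trans ltr01).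
have {}h : pr P S' <= (A * e * K `^ gamma * n.+1%:R / (y / 2)) ^+ p.
  by rewrite expr_div_n ler_pdivlMr// mulrC.
apply: le_trans h _.
have -> : A * e * K `^ gamma * n.+1%:R / (y / 2) = (2 * A * p%:R / th) * (K `^ gamma / K).
  rewrite /y; move: (K `^ gamma) (n.+1%:R) n'0 => u v v0.
  by clearbody th e K; field; rewrite !gt_eqF.
rewrite exprMn ler_wpM2l//; last exact: powR_decay.
by rewrite exprn_ge0// divr_ge0 ?ltW// mulr_gt0// mulr_gt0.
Qed.

Lemma not_few_hits_le (N q : nat) : exists2 C, 0 <= C & forall k, exists n0,
  forall n, (n0 <= n)%N ->
    pr P [set w | ~ few_hits t0 N q.+1%:R^-1 k n (beta w)] <= C / k.+1%:R ^+ 2.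
Proof.
have /andP[g0 g1] := gamma01.
have a0 : 0 < 1 - gamma by rewrite subr_gt0.
(* The order of the moment is the one required by [powR_decay]. *)
pose p := (Num.trunc (3 / (1 - gamma))).+1.
have p3 : 3 <= (1 - gamma) * p%:R.
  by rewrite mulrC -ler_pdivrMr//; apply: ltW; exact: truncnS_gt.
have [C C0 HC] := window_tail N p q p3.
exists (N%:R * C) => [|k]; first by rewrite mulr_ge0.
have [n0 Hn0] := HC k; exists n0 => n nn0.
pose bad j := if (j.+2 <= N * k.+1)%N then
  [set w | (q.+1%:R^-1 * 2^-1 ^+ k * (k.+1 * n.+1)%:R : R) < (window_hits w k n j)%:R] else set0.
have mbad j : measurable (bad j).
  rewrite /bad; case: ifPn => // jN.
  apply: (@measurable_hits_gt _ _ _ t0 N (fun w t => x t w - lvl)) => //.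
    by move=> t /andP[t0t _]; exact: mbeta.
have badC j : pr P (bad j) <= C / k.+1%:R ^+ 3.
  rewrite /bad; case: ifPn => [jN|_]; first exact: Hn0.
  by rewrite /pr measure0/= divr_ge0// exprn_ge0.
have mfew : measurable [set w | ~ few_hits t0 N q.+1%:R^-1 k n (beta w)].
  apply: measurableC; apply: (@measurable_few_hits _ _ _ t0 N (fun w t => x t w - lvl)).
  - by move=> t /andP[t0t _]; exact: mbeta.
  - by rewrite invr_ge0.
have sub : [set w | ~ few_hits t0 N q.+1%:R^-1 k n (beta w)] `<=`
    \big[setU/set0]_(j < N * k.+1) bad j.
  move=> w /= nf; apply: contrapT => nb; apply: nf => j jN.
  rewrite leNgt; apply/negP => h; apply: nb.
  rewrite -bigcup_mkord; exists j; first exact: ltn_trans (ltnSn j) jN.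
  by rewrite /bad jN.
rewrite -lee_fin -prE//.
apply: le_trans (le_measure P _ _ sub) _; rewrite ?inE//.
  by apply: bigsetU_measurable => j _.
apply: le_trans (Boole_inequality P _) _ => //.
apply: (@le_trans _ _ (\sum_(j < N * k.+1) (C / k.+1%:R ^+ 3)%:E)%E).
  apply: lee_sum => j _; have := badC j; rewrite -lee_fin -prE//.
rewrite sumEFin lee_fin sumr_const card_ord -[_ *+ (N * _)]mulr_natr natrM.
have K0 : k.+1%:R != 0 :> R by [].
by rewrite le_eqVlt; apply/orP; left; apply/eqP; field.
Qed.

(** By telescoping, since [1 / a^2 <= 2 / a - 2 / (a + 1)] for [a >= 1]. *)
Lemma sum_inv_sqr_le (n : nat) :
  \sum_(0 <= k < n) (k.+1%:R ^+ 2)^-1 <= 2 :> R.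
Proof.
suff H : \sum_(0 <= k < n) (k.+1%:R ^+ 2)^-1 <= 2 - 2 / n.+1%:R :> R.
  by apply: le_trans H _; rewrite gerBl divr_ge0.
elim: n => [|n IH]; first by rewrite big_geq// divr1 subrr.
rewrite big_nat_recr//=; apply: le_trans (lerD IH (lexx _)) _.
rewrite -[n.+2%:R]natr1; have : 1 <= n.+1%:R :> R by rewrite ler1n.
move: (n.+1%:R) => a a1; have a0 : 0 < a by exact: lt_le_trans a1.
have a10 : 0 < a + 1 by rewrite addr_gt0.
rewrite -subr_ge0.
have -> : 2 - 2 / (a + 1) - (2 - 2 / a + (a ^+ 2)^-1) = (a - 1) / (a ^+ 2 * (a + 1)).
  by field; rewrite !gt_eqF.
by rewrite divr_ge0 ?subr_ge0// mulr_ge0 ?exprn_ge0// ltW.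
Qed.

(** Borel-Cantelli over [k]. The probability bound holds for each large [n] separately, not for all
    at once; the failure at all [n >= m] increases with [m] and is contained in the failure at a
    single large [n], so the bound passes to the union. *)
Lemma rarely_few_hits (N q : nat) : {ae P, forall w, exists k0 : nat,
  forall k, (k0 <= k)%N -> forall m, exists2 n, (m <= n)%N &
    few_hits t0 N q.+1%:R^-1 k n (beta w)}.
Proof.
have [C C0 HC] := not_few_hits_le N q.
pose D k m := [set w | forall n, (m <= n)%N -> ~ few_hits t0 N q.+1%:R^-1 k n (beta w)].
have mnf k n : measurable [set w | ~ few_hits t0 N q.+1%:R^-1 k n (beta w)].
  apply: measurableC; apply: (@measurable_few_hits _ _ _ t0 N (fun w t => x t w - lvl)).
  - by move=> t /andP[t0t _]; exact: mbeta.
  - by rewrite invr_ge0.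
have mD k m : measurable (D k m) by apply: measurable_forall => n _; exact: mnf.
have mB k : measurable (\bigcup_m D k m) by exact: bigcupT_measurable.
have PB k : (P (\bigcup_m D k m) <= (C / k.+1%:R ^+ 2)%:E)%E.
  have ndD : nondecreasing_seq (D k).
    move=> m m' mm'; apply/subsetPset => w Dw n m'n.
    by apply: Dw; exact: leq_trans m'n.
  have cvgD := @nondecreasing_cvg_mu _ _ _ P _ (mD k) (mB k) ndD.
  rewrite -(cvg_lim _ cvgD)//; apply: lime_le; first by apply/cvg_ex; eexists; exact: cvgD.
  apply: nearW => m; have [n0 Hn0] := HC k.
  apply: (@le_trans _ _ (P [set w | ~ few_hits t0 N q.+1%:R^-1 k (maxn n0 m) (beta w)])).
    apply: le_measure; rewrite ?inE//.
    by move=> w Dw; apply: Dw; exact: leq_maxr.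
  by rewrite (prE P _ (mnf _ _)) lee_fin; apply: Hn0; exact: leq_maxl.
exists (lim_sup_set (fun k => \bigcup_m D k m)); split.
- by apply: bigcapT_measurable => k; exact: bigcup_measurable.
- apply: lim_sup_set_cvg0 => //.
  apply: (@le_lt_trans _ _ (C * 2)%:E); last exact: ltry.
  apply: lime_le; first exact: is_cvg_nneseries.
  apply: nearW => n.
  apply: (@le_trans _ _ (\sum_(0 <= k < n) (C / k.+1%:R ^+ 2)%:E)%E).
    by apply: lee_sum => k _; exact: PB.
  by rewrite sumEFin lee_fin -mulr_sumr ler_wpM2l// sum_inv_sqr_le.
- move=> w /= nH k0 _; apply: contrapT => nB; apply: nH.
  exists k0 => k k0k m; apply: contrapT => nf; apply: nB.
  exists k => //; exists m => // n mn few; apply: nf.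
  by exists n.
Qed.

Lemma almost_surely_sparse :
  {ae P, forall w, forall N, sparse t0 N (beta w)}.
Proof.
by apply: ae_foralln => N; apply: ae_foralln => q; exact: rarely_few_hits.
Qed.

End almost_surely_sparse.

(** * Regular paths *)

Lemma limn_sup_leD {R : realType} (u v : nat -> R) (b c : R) :
  (forall n, `|u n| <= b) -> (forall n, `|v n| <= b) ->
  (forall n, u n <= v n + c) -> limn_sup u <= limn_sup v + c.
Proof.
have ub (f : nat -> R) : (forall n, `|f n| <= b) -> has_ubound (range f).
  by move=> fb; exists b => _ [n _ <-]; rewrite (le_trans (ler_norm _)).
have lb (f : nat -> R) : (forall n, `|f n| <= b) -> has_lbound (range f).
  move=> fb; exists (- b) => _ [n _ <-].
  by have := fb n; rewrite ler_norml => /andP[].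
move=> bu bv uv; rewrite -lerBlDr.
have cvu : cvgn (sups u) by apply/cvg_ex; eexists; apply: cvg_sups_inf; [exact: ub|exact: lb].
have cvv : cvgn (sups v) by apply/cvg_ex; eexists; apply: cvg_sups_inf; [exact: ub|exact: lb].
apply: limr_ge => //; apply: nearW => n; rewrite lerBlDr.
apply: (@le_trans _ _ (sups u n)).
  apply: nonincreasing_cvgn_ge => //.
  exact/nonincreasing_sups/ub.
apply: ge_sup; first by exists (u n), n => /=.
move=> _ [k /= nk <-]; apply: le_trans (uv k) _; rewrite lerD2r.
by apply: ub_le_sup; [exact/has_ubound_sdrop/ub|exists k].
Qed.

(** An upper limit makes sense and is Lipschitz for every path, including those where the schemes
    diverge; hypothesis (ii) asks for a process adapted and Lipschitz on all paths. *)
Definition euler_lim {R : realType} (F1 F2 psi : R -> R) (t0 x0 : R)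
    (w : R -> R) (t : R) : R :=
  limn_sup (fun n => euler F1 F2 psi t0 x0 n.+1 w t).

(** Convergence is asked at rational offsets from [t0] up to [t0 + N] only, so that regularity is a
    measurable property of the path on a bounded time interval. *)
Definition regular {R : realType} (F1 F2 : R -> R) (t0 x0 : R) (N : nat)
    (w : R -> R) :=
  (forall q, exists m, forall n, (m <= n)%N -> forall l i, (i <= N * l.+1)%N ->
    `|euler F1 F2 id t0 x0 n.+1 w (tick t0 l.+1 i) -
      euler_lim F1 F2 id t0 x0 w (tick t0 l.+1 i)| <= q.+1%:R^-1) /\
  sparse t0 N (fun t => w t - euler_lim F1 F2 id t0 x0 w t).

Lemma sparse_ext {R : realType} (t0 : R) (N : nat) (f g : R -> R) :
  (forall t, t0 <= t -> f t = g t) -> sparse t0 N f -> sparse t0 N g.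
Proof.
move=> fg sf q; have [k0 Hk0] := sf q; exists k0 => k kk m.
have [n mn H] := Hk0 k kk m; exists n => // j jN.
rewrite /hits -(@eq_count _ (fun i => `|f (tick t0 (k.+1 * n.+1) i)| < 2 * 2^-1 ^+ k)).
  exact: H.
by move=> i; rewrite fg// tick_ge.
Qed.

(** * Convergence of the schemes; existence and uniqueness for regular paths *)

Section euler_limit.
Context {R : realType} (F1 F2 : R -> R) (M t0 x0 : R).
Hypothesis F1_bounded : forall x, `|F1 x| <= M.
Hypothesis F2_bounded : forall x, `|F2 x| <= M.
Hypothesis F1_lipschitz : M.-lipschitz F1.
Hypothesis F2_lipschitz : M.-lipschitz F2.

Let M0 : 0 <= M. Proof. exact: le_trans (normr_ge0 _) (F1_bounded 0). Qed.

Local Notation E psi n w := (euler F1 F2 psi t0 x0 n.+1 w).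
Local Notation Y psi w := (euler_lim F1 F2 psi t0 x0 w).

Lemma euler_lip_on psi n w a b : lip_on a b M (E psi n w).
Proof. by move=> u v _ uv _; exact: euler_lipschitz. Qed.

Lemma euler_dist psi n w u v : `|E psi n w v - E psi n w u| <= M * `|v - u|.
Proof.
have [uv|/ltW vu] := lerP u v; first exact: euler_lipschitz.
by rewrite distrC; exact: euler_lipschitz.
Qed.

Lemma euler_bounded psi n w t : `|E psi n w t| <= `|x0| + M * `|t - t0|.
Proof.
have -> : E psi n w t = x0 + (E psi n w t - E psi n w t0).
  by rewrite (euler_start _ _ _ _ _ _ _ _ t0)//; ring.
by apply: le_trans (ler_normD _ _) _; rewrite lerD2l euler_dist.
Qed.

Lemma euler_lim_lipschitz psi w u v : u <= v -> `|Y psi w v - Y psi w u| <= M * (v - u).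
Proof.
move=> uv; pose b := Num.max (`|x0| + M * `|u - t0|) (`|x0| + M * `|v - t0|).
have bu n : `|E psi n w u| <= b.
  by apply: le_trans (euler_bounded psi n w u) _; rewrite le_max lexx.
have bv n : `|E psi n w v| <= b.
  by apply: le_trans (euler_bounded psi n w v) _; rewrite le_max lexx orbT.
have H n : `|E psi n w v - E psi n w u| <= M * (v - u) by exact: euler_lipschitz.
have h1 : Y psi w u <= Y psi w v + M * (v - u).
  by apply: (limn_sup_leD _ _ b) => // n; have := H n; rewrite ler_norml; lra.
have h2 : Y psi w v <= Y psi w u + M * (v - u).
  by apply: (limn_sup_leD _ _ b) => // n; have := H n; rewrite ler_norml; lra.
by rewrite ler_norml; apply/andP; split; lra.
Qed.

Lemma euler_lim_lip_on psi w a b : lip_on a b M (Y psi w).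
Proof. by move=> u v _ uv _; exact: euler_lim_lipschitz. Qed.

Lemma euler_lim_dist psi w u v : `|Y psi w v - Y psi w u| <= M * `|v - u|.
Proof.
have [uv|/ltW vu] := lerP u v; first exact: euler_lim_lipschitz.
by rewrite distrC; exact: euler_lim_lipschitz.
Qed.

Lemma euler_limE psi w t l : E psi n w t @[n --> \oo] --> l -> Y psi w t = l.
Proof. by move=> /cvg_limn_inf_sup[_]. Qed.

Lemma euler_lim_start psi w : Y psi w t0 = x0.
Proof.
apply: euler_limE; apply: cvg_near_cst; apply: nearW => n.
exact: euler_start.
Qed.

Lemma within_timeline (w : R -> R) : {within timeline t0, continuous w} ->
  forall T, {within `[t0, T], continuous w}.
Proof.
move=> cw T; apply: continuous_subspaceW cw => t /=.
by rewrite /timeline/= !in_itv/= andbT => /andP[].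
Qed.

Lemma horizon (t : R) : exists N : nat, t + 2 <= t0 + N%:R.
Proof.
exists (Num.trunc (t + 2 - t0)).+1.
by have := truncnS_gt (t + 2 - t0); lra.
Qed.

Lemma euler_lim_approx (psi w : R -> R) (T : R) : (forall x y, `|psi x - psi y| <= `|x - y|) ->
  {within timeline t0, continuous w} ->
  (forall t, t0 <= t -> E psi n w t @[n --> \oo] --> Y psi w t) ->
  forall eta, 0 < eta -> exists2 rho, 0 < rho &
    approx_solution F1 F2 t0 T eta rho (fun t => w t - psi (Y psi w t)) (Y psi w).
Proof.
move=> lpsi cw EY eta eta0; have eta2 : 0 < eta / 2 by rewrite divr_gt0.
have [rho rho0 [n0 Hn0]] := euler_approx_solution F1 F2 psi t0 x0 T M w F1_bounded
  F2_bounded F1_lipschitz F2_lipschitz lpsi (within_timeline w cw T) (eta / 2) eta2.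
exists rho => //; have -> : eta = 2 * (eta / 2) by rewrite mulrCA divff// mulr1.
apply: (approx_solution_lim F1 F2 psi w _ (fun n => E psi n w) M t0 T _ rho n0) => //.
by move=> t t0t _; exact: EY.
Qed.

(** With [psi = cst lvl] all schemes share the same signed distance [w - lvl], which is sparse, so
    [comparison] makes them a Cauchy sequence. *)
Lemma euler_cst_cvg (lvl : R) (w : R -> R) : {within timeline t0, continuous w} ->
  (forall N, sparse t0 N (fun t => w t - lvl)) ->
  forall t, t0 <= t -> E (cst lvl) n w t @[n --> \oo] --> Y (cst lvl) w t.
Proof.
move=> cw sp t t0t.
suff : cvg (E (cst lvl) n w t @[n --> \oo]).
  move=> /cvg_ex[l El]; have El' : E (cst lvl) n w t @[n --> \oo] --> l by exact: El.
  by rewrite (euler_limE _ _ _ _ El').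
apply/cauchy_cvgP/cauchy_exP => e e0.
have [N tN] := horizon t.
have e2 : 0 < e / 2 by rewrite divr_gt0.
have [eta eta0 H] := comparison F1 F2 M M t0 (e / 2) N _ F1_lipschitz F2_lipschitz M0 M0 e2 (sp N).
have lpsi (x y : R) : `|cst lvl x - cst lvl y| <= `|x - y| by rewrite subrr normr0.
have [rho rho0 [n0 Hn0]] := euler_approx_solution F1 F2 (cst lvl) t0 x0 (t0 + N%:R) M w F1_bounded
  F2_bounded F1_lipschitz F2_lipschitz lpsi (within_timeline w cw _) eta eta0.
exists (E (cst lvl) n0 w t); exists n0 => // n /= nn0.
rewrite /ball/=; apply: (@le_lt_trans _ _ (e / 2)); last by rewrite ltr_pdivrMr// ltr_pMr// ltr1n.
apply: (H rho (fun t => w t - lvl)) => //.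
- exact: euler_lip_on.
- exact: euler_lip_on.
- exact: (Hn0 n0 (leqnn _)).
- exact: (Hn0 n nn0).
- by move=> u _ _; rewrite subrr normr0.
- by rewrite !euler_start.
Qed.

(* Z solves dZ/dt = F1 (Z) or F2 (Z) according to the sign of w - lvl, which is
   the sign of b - Z: Z solves the equation driven by b. *)
Lemma regular_of_sparse (lvl : R) (w : R -> R) (N : nat) : {within timeline t0, continuous w} ->
  (forall N, sparse t0 N (fun t => w t - lvl)) ->
  regular F1 F2 t0 x0 N (fun t => w t + Y (cst lvl) w t - lvl).
Proof.
move=> cw sp; set b := (fun t => _); set Z := Y (cst lvl) w.
have bZ t : b t - Z t = w t - lvl by rewrite /b /Z; ring.
have cZ : {within timeline t0, continuous Z}.
  apply: continuous_subspaceT => t; apply: (dist_le_continuous Z M M0).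
  exact: euler_lim_dist.
have cb : {within timeline t0, continuous b}.
  move=> t; apply: cvgB; last exact: cvg_cst.
  by apply: cvgD; [exact: cw|exact: cZ].
(* [comparison] is applied to [Z], at distance [b - Z = w - lvl], and to the scheme [E], at distance
   [b - E]: the distances differ by exactly [E - Z]. The extra 2 in [N'] is the time that
   [comparison] loses before its horizon. *)
have close H e : 0 < e -> exists n0, forall n, (n0 <= n)%N ->
    forall t, t0 <= t -> t <= t0 + H%:R -> `|E id n b t - Z t| <= e.
  move=> e0; pose N' := (H + 2)%N.
  have [eta eta0 cmp] := comparison F1 F2 M M t0 e N' _ F1_lipschitz F2_lipschitz M0 M0 e0 (sp N').
  have [rho1 rho10 [n0 Hn0]] := euler_approx_solution F1 F2 id t0 x0 (t0 + N'%:R) M b F1_bounded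
    F2_bounded F1_lipschitz F2_lipschitz (fun x y => lexx _) (within_timeline b cb _) eta eta0.
  have lpsi (x y : R) : `|cst lvl x - cst lvl y| <= `|x - y| by rewrite subrr normr0.
  have [rho2 rho20 A] := euler_lim_approx (cst lvl) w (t0 + N'%:R) lpsi cw
    (euler_cst_cvg lvl w cw sp) eta eta0.
  exists n0 => n nn0 t t0t tN; rewrite distrC.
  apply: (cmp (Num.min rho1 rho2) (fun t => b t - E id n b t)) => //.
  - by rewrite lt_min rho10.
  - exact: euler_lim_lip_on.
  - exact: euler_lip_on.
  - move=> u v t0u uv vN; rewrite le_min => /andP[_ vu2].
    exact: (A u v t0u uv vN vu2).
  - move=> u v t0u uv vN; rewrite le_min => /andP[vu1 _].
    exact: (Hn0 n nn0 u v t0u uv vN vu1).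
  - move=> u _ _; rewrite -bZ.
    by rewrite (_ : _ - _ - _ = E id n b u - Z u); [rewrite distrC|ring].
  - by rewrite euler_start// /Z euler_lim_start.
  - by rewrite /N' natrD; lra.
have YZ t : t0 <= t -> Y id b t = Z t.
  move=> t0t; apply: euler_limE; apply/cvgrPdist_le => e e0.
  have [H tH] := horizon t.
  have [n0 Hn0] := close H e e0; exists n0 => // n /= nn0.
  by rewrite distrC; apply: Hn0 => //; lra.
have tickN l i : (i <= N * l.+1)%N -> tick t0 l.+1 i <= t0 + N%:R.
  by move=> iN; rewrite /tick lerD2l ler_pdivrMr ?ltr0n// -natrM ler_nat.
split.
  move=> q; have [n0 Hn0] := close N q.+1%:R^-1 ltac:(by rewrite invr_gt0).
  exists n0 => n nn0 l i iN.
  by rewrite YZ ?tick_ge//; apply: Hn0; rewrite ?tick_ge ?tickN.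
by apply: sparse_ext (sp N) => t t0t; rewrite YZ// bZ.
Qed.

(** The index [m] serves all ticks of all grids, and the schemes are equi-Lipschitz: a tick close
    enough to [t] carries the convergence over to [t]. *)
Lemma regular_cvg (w : R -> R) : (forall N, regular F1 F2 t0 x0 N w) ->
  forall t, t0 <= t -> E id n w t @[n --> \oo] --> Y id w t.
Proof.
move=> rw t t0t; apply/cvgrPdist_le => e e0.
have [N tN] := horizon t.
have [q Hq] := @eventually_invS_le R (e / 2) ltac:(by rewrite divr_gt0).
have Me : 0 < e / (4 * (M + 1)) by rewrite divr_gt0// mulr_gt0// ltr_wpDl.
have [l Hl] := eventually_invS_le _ Me.
have {}Hl := Hl l (leqnn l); have {}Hq := Hq q (leqnn q).
have [m Hm] := (rw N).1 q.
exists m => // n /= mn.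
have l0 : 0 < l.+1%:R :> R by rewrite ltr0n.
have tl0 : 0 <= (t - t0) * l.+1%:R by rewrite mulr_ge0// subr_ge0.
have [i /andP[i1 i2]] := nat_floor _ tl0.
pose r := tick t0 l.+1 i.
have rt : r <= t by rewrite /r /tick -lerBrDl ler_pdivrMr.
have tr : t - r <= l.+1%:R^-1.
  have : t <= tick t0 l.+1 i.+1 by rewrite /tick -lerBlDl ler_pdivlMr// ltW.
  by rewrite tickS -/r; move: (l.+1%:R^-1) (r) => h a; lra.
have iN : (i <= N * l.+1)%N.
  rewrite -(ler_nat R) natrM; apply: le_trans i1 _; rewrite ler_pM2r//; lra.
have h1 : `|E id n w r - Y id w r| <= e / 2 by apply: le_trans (Hm n mn l i iN) _.
have Mr : M * (t - r) <= e / 4.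
  have : (M + 1) * (t - r) <= e / 4.
    apply: (@le_trans _ _ ((M + 1) * (e / (4 * (M + 1))))).
      by rewrite ler_wpM2l ?addr_ge0// (le_trans tr).
    have M1 : M + 1 != 0 by rewrite gt_eqF// ltr_wpDl.
    by rewrite le_eqVlt; apply/orP; left; apply/eqP; field.
  have : 0 <= t - r by rewrite subr_ge0.
  by lra.
have h2 : `|E id n w t - E id n w r| <= e / 4.
  by apply: le_trans Mr; exact: euler_lipschitz.
have h3 : `|Y id w t - Y id w r| <= e / 4.
  by apply: le_trans Mr; exact: euler_lim_lipschitz.
have -> : Y id w t - E id n w t = (Y id w t - Y id w r) - (E id n w r - Y id w r)
  - (E id n w t - E id n w r) by ring.
apply: le_trans (ler_normB _ _) _; apply: le_trans (lerD (ler_normB _ _) (lexx _)) _.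
by lra.
Qed.

(** The limit of the schemes is a solution [Y] with [w - Y] sparse. Sparseness of this single
    distance suffices to compare [Y] with any other solution [Z], whatever the Lipschitz constant of
    [Z]. *)
Lemma regular_unique_solution (w : R -> R) : {within timeline t0, continuous w} ->
  (forall N, regular F1 F2 t0 x0 N w) ->
  exists2 X : R -> R, lipschitz_solution F1 F2 t0 x0 w X &
    forall Z : R -> R, lipschitz_solution F1 F2 t0 x0 w Z ->
      forall t, t0 <= t -> Z t = X t.
Proof.
move=> cw rw.
have approxY T := euler_lim_approx id w T (fun x y => lexx _) cw (regular_cvg w rw).
exists (Y id w).
  apply: (approx_lipschitz_solution F1 F2 w (Y id w) M t0 x0) => //.
  - exact: within_timeline.
  - by move=> u v; exact: euler_lim_lipschitz.
  - exact: euler_lim_start.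
move=> Z solZ t t0t; have [/lipschitz_lip_on[L L0 lZ] Zt0 _] := solZ.
have [N tN] := horizon t.
have lip_onW (L1 L2 : R) (f : R -> R) (a b : R) : L1 <= L2 -> lip_on a b L1 f -> lip_on a b L2 f.
  move=> L12 lf u v au uv vb; apply: le_trans (lf u v au uv vb) _.
  by rewrite ler_wpM2r// subr_ge0.
apply/eqP; rewrite eq_sym -subr_eq0 -normr_le0; apply/ler_addgt0Pr => e e0.
rewrite add0r.
have L'0 : 0 <= Num.max M L by rewrite le_max M0.
have [eta eta0 cmp] := comparison F1 F2 M (Num.max M L) t0 e N _ F1_lipschitz F2_lipschitz M0 L'0 e0 (rw N).2.
have [rho1 rho10 A1] := approxY (t0 + N%:R) eta eta0.
have [rho2 rho20 A2] := lipschitz_solution_approx F1 F2 w Z M t0 x0 (t0 + N%:R) M0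
  F1_lipschitz F2_lipschitz (within_timeline w cw _) solZ eta eta0.
apply: (cmp (Num.min rho1 rho2) (fun t => w t - Z t)) => //.
- by rewrite lt_min rho10.
- by apply: (lip_onW M (Num.max M L) (Y id w) t0 (t0 + N%:R)); [rewrite le_max lexx|exact: euler_lim_lip_on].
- by apply: (lip_onW L (Num.max M L) Z t0 (t0 + N%:R)) => //; rewrite le_max lexx orbT.
- move=> u v t0u uv vN; rewrite le_min => /andP[vu1 _].
  exact: (A1 u v t0u uv vN vu1).
- move=> u v t0u uv vN; rewrite le_min => /andP[_ vu2].
  exact: (A2 u v t0u uv vN vu2).
- move=> u _ _; rewrite (_ : _ - _ - _ = Z u - Y id w u); last by ring.
  by rewrite distrC.
- by rewrite Zt0 euler_lim_start.
Qed.

End euler_limit.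

(** * Measurability *)

Lemma lipschitz_measurable {R : realType} (F : R -> R) (M : R) :
  0 <= M -> M.-lipschitz F -> measurable_fun setT F.
Proof.
move=> M0 lF; apply: continuous_measurable_fun.
apply: (dist_le_continuous F M M0) => u v.
exact: (lF (v, u) (conj I I)).
Qed.

Section measurable_euler.
Context {R : realType} {d} {T : measurableType d} (F1 F2 psi : R -> R)
  (M t0 x0 : R) (beta : T -> R -> R).
Hypothesis mF1 : measurable_fun setT F1.
Hypothesis mF2 : measurable_fun setT F2.
Hypothesis mpsi : measurable_fun setT psi.

Lemma measurable_slope m i (X : T -> R) :
  measurable_fun setT (beta ^~ (tick t0 m i)) -> measurable_fun setT X ->
  measurable_fun setT (fun w => slope F1 F2 psi t0 m (beta w) i (X w)).
Proof.
move=> mb mX; apply: measurable_fun_ifT.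
- by apply: measurable_fun_ltr => //; exact: (measurableT_comp mpsi mX).
- exact: (measurableT_comp mF1 mX).
- exact: (measurableT_comp mF2 mX).
Qed.

Lemma measurable_euler_state m i :
  (forall j, (j < i)%N -> measurable_fun setT (beta ^~ (tick t0 m j))) ->
  measurable_fun setT (fun w => euler_state F1 F2 psi t0 x0 m (beta w) i).
Proof.
elim: i => [|i IH] mb /=; first exact: measurable_cst.
have mi := IH (fun j ji => mb j (ltnW ji)).
apply: measurable_funD => //; apply: measurable_funM; first exact: measurable_cst.
by apply: measurable_slope => //; exact: mb.
Qed.

(** The last cell used starts at a tick not after [t], so only the path up to [t] is read. Over
    [history], this measurability is adaptedness. *)
Lemma measurable_euler m t : (0 < m)%N -> t0 <= t ->
  (forall u, t0 <= u <= t -> measurable_fun setT (beta ^~ u)) ->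
  measurable_fun setT (fun w => euler F1 F2 psi t0 x0 m (beta w) t).
Proof.
move=> m0 t0t mb; rewrite /euler /euler_upto.
have [i1 i2] : 0 <= (t - t0) * m%:R /\ 0 < m%:R :> R.
  by rewrite mulr_ge0 ?subr_ge0// ltr0n.
have /andP[h _] := truncn_itv i1.
have mj j : (j <= Num.trunc ((t - t0) * m%:R))%N ->
    measurable_fun setT (beta ^~ (tick t0 m j)).
  move=> jJ; apply: mb; rewrite tick_ge/= /tick -lerBrDl ler_pdivrMr//.
  by apply: le_trans h; rewrite ler_nat.
apply: measurable_funD; first exact: measurable_cst.
have : ((Num.trunc ((t - t0) * m%:R)).+1 <= (Num.trunc ((t - t0) * m%:R)).+1)%N by [].
(* Only the number of terms is generalized; the bound on the ticks stays fixed during the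
   induction. *)
move: {1 3}(_.+1) => J; elim: J => [|J IH] JJ.
  under eq_fun do rewrite big_geq//.
  exact: measurable_cst.
under eq_fun do rewrite big_nat_recr//=.
apply: measurable_funD; first by apply: IH; exact: ltnW.
apply: measurable_funM; first exact: measurable_cst.
apply: measurable_slope; first exact: mj.
by apply: measurable_euler_state => j jJ; apply: mj; apply: leq_trans (ltnW jJ) _.
Qed.

Hypothesis F1_bounded : forall x, `|F1 x| <= M.
Hypothesis F2_bounded : forall x, `|F2 x| <= M.

Lemma measurable_euler_lim t : t0 <= t ->
  (forall u, t0 <= u <= t -> measurable_fun setT (beta ^~ u)) ->
  measurable_fun setT (fun w => euler_lim F1 F2 psi t0 x0 (beta w) t).
Proof.
move=> t0t mb.
apply: (@measurable_fun_limn_sup _ _ _ _ (fun n w => euler F1 F2 psi t0 x0 n.+1 (beta w) t)).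
- move=> w _; exists (`|x0| + M * `|t - t0|) => _ [n _ <-].
  by apply: le_trans (ler_norm _) _; exact: euler_bounded.
- move=> w _; exists (- (`|x0| + M * `|t - t0|)) => _ [n _ <-].
  have := euler_bounded F1 F2 M t0 x0 F1_bounded F2_bounded psi n (beta w) t.
  by rewrite ler_norml => /andP[].
- by move=> n; exact: measurable_euler.
Qed.

End measurable_euler.

Lemma measurable_regular {R : realType} {d} {T : measurableType d}
    (F1 F2 : R -> R) (M t0 x0 : R) (N : nat) (beta : T -> R -> R) :
  (forall x, `|F1 x| <= M) -> (forall x, `|F2 x| <= M) ->
  M.-lipschitz F1 -> M.-lipschitz F2 ->
  (forall t, t0 <= t <= t0 + N%:R -> measurable_fun setT (beta ^~ t)) ->
  measurable [set w | regular F1 F2 t0 x0 N (beta w)].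
Proof.
move=> bF1 bF2 lF1 lF2 mb.
have M0 : 0 <= M := le_trans (normr_ge0 _) (bF1 0).
have mF1 := lipschitz_measurable F1 M M0 lF1.
have mF2 := lipschitz_measurable F2 M M0 lF2.
have mid : measurable_fun setT (id : R -> R) by exact: measurable_id.
have mb' t : t0 <= t <= t0 + N%:R -> forall u, t0 <= u <= t -> measurable_fun setT (beta ^~ u).
  by move=> /andP[_ tN] u /andP[t0u ut]; apply: mb; rewrite t0u (le_trans ut).
have mY t : t0 <= t <= t0 + N%:R ->
    measurable_fun setT (fun w => euler_lim F1 F2 id t0 x0 (beta w) t).
  move=> tN; apply: (measurable_euler_lim F1 F2 id M) => //; last exact: mb'.
  by case/andP: tN.
apply: measurableI; last first.
  apply: (@measurable_sparse _ _ _ t0 N (fun w t => beta w t - euler_lim F1 F2 id t0 x0 (beta w) t)).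
  by move=> t tN; apply: measurable_funB; [exact: mb|exact: mY].
rewrite [X in measurable X](_ : _ = [set w | forall q : nat, True -> exists2 m : nat, True &
   forall n : nat, (m <= n)%N -> forall l : nat, True ->
   forall i : nat, (i <= N * l.+1)%N ->
    `|euler F1 F2 id t0 x0 n.+1 (beta w) (tick t0 l.+1 i) -
      euler_lim F1 F2 id t0 x0 (beta w) (tick t0 l.+1 i)| <= q.+1%:R^-1]).
  apply: measurable_forall => q _; apply: measurable_exists2 => m _.
  apply: measurable_forall => n _; apply: measurable_forall => l _.
  apply: measurable_forall => i iN.
  have tN : t0 <= tick t0 l.+1 i <= t0 + N%:R.
    by rewrite tick_ge/= /tick lerD2l ler_pdivrMr ?ltr0n// -natrM ler_nat.
  rewrite -[X in measurable X]setTI; apply: measurable_fun_le => //.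
  apply: measurableT_comp; first exact: normr_measurable.
  apply: measurable_funB; last exact: mY.
  by apply: measurable_euler => //; [case/andP: tN|exact: mb'].
apply/seteqP; split => w H q.
  by move=> _; have [m Hm] := H q; exists m => // n mn l _ i; exact: Hm.
by have [m _ Hm] := H q I; exists m => n mn l i; exact: Hm.
Qed.

Section path_measurability.
Context {R : realType} (I : set R).

Lemma measurable_eval_at t : I t ->
  measurable_fun setT (@eval_at R I t).
Proof.
move=> It _ A mA; apply: sub_sigma_algebra; exists t => //.
by exists A.
Qed.

Lemma measurable_to_path {d} {T : measurableType d} (f : T -> path_space I) :
  (forall t, I t -> measurable_fun setT (fun w => eval_at t (f w))) ->
  measurable_fun setT f.
Proof.
move=> mf; apply: (@measurability _ _ _ _ setT f
  (generators I (fun (t : R) (w : contfun I) => (w t : R)))) => //.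
move=> _ [_ [t It [A mA <-]] <-]; rewrite setTI setTI.
rewrite -[X in measurable X]setTI.
exact: (mf t It measurableT A mA).
Qed.

Lemma lipschitz_path_continuous (f : R -> R) (L : R) : 0 <= L ->
  (forall u v, `|f v - f u| <= L * `|v - u|) -> continuous (f : subspace I -> R).
Proof.
move=> L0 lf; apply: continuous_subspaceT => t.
exact: (dist_le_continuous f L L0 lf).
Qed.

End path_measurability.

(** * Absolute continuity *)

Lemma measurable_history {R : realType} {d} {T : measurableType d} (t0 t u : R)
    (x : R -> T -> R) : t0 <= u <= t ->
  measurable_fun setT (x u : history t0 x t -> R).
Proof.
move=> tu _ A mA; apply: sub_sigma_algebra; exists u; first by rewrite /= in_itv.
by exists A.
Qed.

(** The probability is the integral of the nonnegative [k (X w) E]. One direction sends null sets to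
    almost every starting point, the other brings them back. *)
Lemma ae_kernel0 {R : realType} {d1 d2 d3} {T : measurableType d1}
    {T1 : measurableType d2} {T2 : measurableType d3} (P : probability T R)
    (X : T -> T1) (Y : T -> T2) (k : R.-pker T1 ~> T2) (E : set T2) :
  measurable_fun setT X -> conditional_law P X Y k -> measurable E ->
  P (Y @^-1` E) = 0%E <-> {ae P, forall w, k (X w) E = 0%E}.
Proof.
move=> mX law mE.
have := law setT E measurableT mE; rewrite preimage_setT setTI => ->.
have mk : measurable_fun setT (fun w => k (X w) E).
  exact: (measurableT_comp (measurable_kernel k E mE) mX).
have -> : (\int[P]_(w in setT) k (X w) E = \int[P]_(w in setT) `|k (X w) E|)%E.
  by apply: eq_integral => w _; rewrite gee0_abs.
rewrite (ae_eq_integral_abs P measurableT mk).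
split; apply: (@filterS _ _ (ae_filter_ringOfSetsType P)) => w.
  exact.
by move=> h _.
Qed.

Theorem theorem2p5 (R : realType) (d : measure_display) (T : measurableType d)
    (P : probability T R) (t0 x0 M : R) (F1 F2 : R -> R)
    (F1_bounded : forall x, `|F1 x| <= M) (F2_bounded : forall x, `|F2 x| <= M)
    (F1_lipschitz : M.-lipschitz F1) (F2_lipschitz : M.-lipschitz F2)
    (B : {RV P >-> path_space (timeline t0)})
    (Px : R.-pker (measurableTypeR R) ~> path_space (timeline t0))
    (Px_law : law_given_start P B Px)
    (cond_i : exists c1 gamma : R, [/\ 0 < c1, 0 < gamma < 1 &
       conditional_density_bound P t0 (fun t w => eval_at t (B w)) c1 gamma])
    (cond_ii : shift_quasi_invariant x0 M Px) :
  {ae P, forall w, exists2 X : R -> R,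
     lipschitz_solution F1 F2 t0 x0 (fun t => eval_at t (B w)) X &
     forall Y : R -> R,
       lipschitz_solution F1 F2 t0 x0 (fun t => eval_at t (B w)) Y ->
       forall t, t0 <= t -> Y t = X t}.
Proof.
have M0 : 0 <= M := le_trans (normr_ge0 _) (F1_bounded 0).
have [c1 [gamma [c10 gamma01 density]]] := cond_i.
have [law _] := Px_law.
have mev t : t0 <= t -> measurable_fun setT (@eval_at R (timeline t0) t).
  by move=> t0t; apply: measurable_eval_at; rewrite /timeline/= in_itv/= t0t.
have mBt t : t0 <= t -> measurable_fun setT (fun w => eval_at t (B w)).
  by move=> t0t; exact: (measurableT_comp (mev t t0t) (measurable_funPT B)).
have pathc (w : path_space (timeline t0)) :
    {within timeline t0, continuous (fun t => eval_at t w)}.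
  exact: (@cts_fun _ _ (w : contfun (timeline t0))).
pose Bad : set (path_space (timeline t0)) :=
  ~` [set b | forall N : nat, True -> sparse t0 N (fun t => eval_at t b - x0)].
have mBad : measurable Bad.
  apply: measurableC; apply: measurable_forall => N _.
  apply: (@measurable_sparse _ _ _ t0 N (fun b t => eval_at t b - x0)).
  move=> t /andP[t0t _]; apply: measurable_funB; [exact: mev|exact: measurable_cst].
have PBad : P (B @^-1` Bad) = 0%E.
  have [Z [mZ PZ subZ]] := almost_surely_sparse P t0 c1 gamma x0
    (fun t w => eval_at t (B w)) mBt c10 gamma01 density.
  apply: (subset_measure0 _ mZ _ PZ).
    by rewrite -[X in measurable X]setTI; exact: (measurable_funPT B).
  by move=> w nw; apply: subZ => /= h; apply: nw => N _; exact: h.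
have Bad0 := (ae_kernel0 P _ B Px Bad (mBt t0 (lexx _)) law mBad).1 PBad.
pose Irr N : set (path_space (timeline t0)) :=
  ~` [set b | regular F1 F2 t0 x0 N (fun t => eval_at t b)].
have mIrr N : measurable (Irr N).
  apply: measurableC; apply: (measurable_regular F1 F2 M) => //.
  by move=> t /andP[t0t _]; exact: mev.
have Irr0 N x : Px x Bad = 0%E -> Px x (Irr N) = 0%E.
  move=> xBad.
  pose A (b : path_space (timeline t0)) : path_space (timeline t0) :=
    mkcts (@lipschitz_path_continuous R (timeline t0)
      (euler_lim F1 F2 (cst x0) t0 x0 (fun t => eval_at t b)) M M0
      (euler_lim_dist F1 F2 M t0 x0 F1_bounded F2_bounded (cst x0) _)).
  pose C (b : path_space (timeline t0)) : path_space (timeline t0) :=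
    (cst x0 : continuousType (subspace (timeline t0)) R).
  (* The horizon [N + 1] is positive even for [N = 0], and it covers all times up to [t0 + N]. *)
  have s0 : 0 < N.+1%:R :> R by rewrite ltr0n.
  have mF1 := lipschitz_measurable F1 M M0 F1_lipschitz.
  have mF2 := lipschitz_measurable F2 M M0 F2_lipschitz.
  have adA : adapted A.
    move=> t t0t; apply: (measurable_euler_lim F1 F2 (cst x0) M t0 x0
      (fun (b : history t0 (@eval_at R (timeline t0)) t) t => eval_at t b)) => //.
    by move=> u tu; exact: measurable_history.
  have startA b : eval_at t0 (A b) = x0.
    exact: (euler_lim_start F1 F2 t0 x0).
  have lipA b : M.-lipschitz_(timeline t0) (fun t : R => eval_at t (A b)).
    move=> [u v] /= _.
    exact: (euler_lim_dist F1 F2 M t0 x0 F1_bounded F2_bounded).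
  (* By (ii), B + x0 and B + A B have equivalent laws given the starting point;
     moreover B + A B - x0 is regular as soon as B - x0 is sparse. *)
  have [_ A2] := cond_ii A adA startA lipA x N.+1%:R s0.
  have adC : adapted C by move=> t t0t; exact: measurable_cst.
  have lipC b : M.-lipschitz_(timeline t0) (fun t : R => eval_at t (C b)).
    by move=> [u v] /= _; rewrite subrr normr0 mulr_ge0.
  have [C1 _] := cond_ii C adC (fun=> erefl) lipC x N.+1%:R s0.
  (* The pullback of [W] by [b + x0] is [Irr N], while its pullback by [b + A b] is contained in
     [Bad]. *)
  pose W : set (path_space `[t0, t0 + N.+1%:R]) :=
    ~` [set v | regular F1 F2 t0 x0 N (fun t => eval_at t v - x0)].
  have mW : measurable W.
    apply: measurableC; apply: (measurable_regular F1 F2 M t0 x0 N (fun v t => eval_at t v - x0)) => //.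
    move=> t /andP[t0t tN]; apply: measurable_funB; last exact: measurable_cst.
    apply: measurable_eval_at; rewrite /= in_itv/= t0t (le_trans tN)//.
    by rewrite lerD2l ler_nat.
  (* Nullity of [W] passes from [B + A] given [x] to [B] given [x + x0], then to [B + x0] given
     [x]. *)
  have WC := C1 W (A2 W _) W mW (fun _ h => h).
  have -> : Irr N = (fun b => path_upto (t0 + N.+1%:R) (path_add b (C b))) @^-1` W.
    have E b : (fun t => eval_at t (path_upto (t0 + N.+1%:R) (path_add b (C b))) - x0)
        = (fun t => eval_at t b) by apply/funext => t; exact: addrK.
    by apply/seteqP; split => b; rewrite /Irr /W /= E.
  apply: WC => D mD DW; apply: (subset_measure0 _ mBad _ xBad).
    rewrite -[X in measurable X]setTI.
    suff : measurable_fun setT (fun b => path_upto (t0 + N.+1%:R) (path_add b (A b))).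
      by apply.
    apply: measurable_to_path => t; rewrite /= in_itv/= => /andP[t0t _].
    apply: measurable_funD; first exact: mev.
    apply: (measurable_euler_lim F1 F2 (cst x0) M t0 x0
      (fun (b : path_space (timeline t0)) t => eval_at t b)) => //.
    by move=> u /andP[t0u _]; exact: mev.
  move=> b Db nb; apply: (DW _ Db).
  exact: (regular_of_sparse F1 F2 M t0 x0 F1_bounded F2_bounded F1_lipschitz F2_lipschitz
    x0 (fun t => eval_at t b) N (pathc b) (fun N => nb N I)).
have allIrr : {ae P, forall w, forall N, ~ Irr N (B w)}.
  apply: ae_foralln => N.
  have [_ PI] := ae_kernel0 P _ B Px (Irr N) (mBt t0 (lexx _)) law (mIrr N).
  exists (B @^-1` Irr N); split.
  - by rewrite -[X in measurable X]setTI; exact: (measurable_funPT B).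
  - apply: PI; move: Bad0; apply: (@filterS _ _ (ae_filter_ringOfSetsType P)) => w.
    exact: Irr0.
  - by move=> w /= /contrapT.
move: allIrr; apply: (@filterS _ _ (ae_filter_ringOfSetsType P)) => w reg.
apply: (regular_unique_solution F1 F2 M) => // N.
by apply: contrapT; exact: reg.
Qed.
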